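(* For every $\delta\in[0,1)$ and every $\alpha\in(\delta/3,1/3)$ there exists $\epsilon>0$ with the following property. For all constants $0<c_1\le c_2$ there are $C>0$ and $n_0$ such that for all $n\ge n_0$, setting $N=2n-2$, for every prime $p$ with $c_1N^\alpha\le p\le c_2N^\alpha$, every integer $\ell\le N+N^\delta$ and every $(\epsilon\log N)^{1/2}$-local function $f:\{0,1\}^\ell\to\{0,1\}^{N+1}$, $$\Delta\big(f(U),\,(Z,\mathrm{pmmajmod}_p(Z))\big)\ \ge\ \tfrac12-\tfrac{C}{\log N},$$ where $U$ is uniform on $\{0,1\}^\ell$ and $Z$ is uniform on $\{0,1\}^N$.
   Context: Binary tree $B_n$: vertices $v_0,\dots,v_{n-1}$ with root $v_0$; for $i\ge1$ the parent of $v_i$ is $v_{\lfloor (i-1)/2\rfloor}$ and $e_i$ is the edge joining $v_i$ to its parent. For $d\in\{0,1\}^{n-1}$ define $h(d)\in\{0,1\}^{n-1}$ by $h(d)_i=\bigoplus_{j:\,e_j\text{ lies on the path from }v_0\text{ to }v_i} d_j$. For an odd prime $p$ and integer $a$ let $\mathrm{MM}_p(a)=0$ if $(a\bmod p)\in\{0,\dots,(p-1)/2\}$ and $1$ otherwise (with $a\bmod p\in\{0,\dots,p-1\}$). For $z=(d,x)\in\{0,1\}^{n-1}\times\{0,1\}^{n-1}$ (first $n-1$ bits $d$, next $n-1$ bits $x$), $\mathrm{pmmajmod}_p(z)=\mathrm{MM}_p\big(\sum_{i=1}^{n-1}x_i(-1)^{h(d)_i}\big)\oplus\mathrm{parity}(x)$,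 where $\mathrm{parity}(x)=\sum_i x_i\bmod 2$. A function $f:\{0,1\}^\ell\to\{0,1\}^m$ is $d$-local if each output bit depends on at most $d$ input bits. $\Delta(D_1,D_2)=\max_{T}|\Pr[D_1\in T]-\Pr[D_2\in T]|$ is total variation distance. *)

(* Defs.v *)
From HB Require Import structures.
From mathcomp Require Import all_boot all_order all_algebra.
From mathcomp Require Import reals exp.
Set Implicit Arguments. Unset Strict Implicit. Unset Printing Implicit Defensive.
Import Order.TTheory GRing.Theory Num.Theory.

Local Open Scope ring_scope.

(* bit k of a bitstring z (0-indexed); false outside the range *)
Definition zbit (m : nat) (z : {ffun 'I_m -> bool}) (k : nat) : bool :=
  if @insub nat (fun i => i < m)%N 'I_m k is Some i then z i else false.

(* parent of v_i in the binary tree B_n : v_{floor((i-1)/2)} *)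
Definition par (i : nat) : nat := (i.-1 %/ 2)%N.

(* e_j lies on the path from v_0 to v_i  (j >= 1 and v_j is an ancestor-or-self of v_i) *)
Definition on_path (j i : nat) : bool :=
  (1 <= j)%N && [exists k : 'I_i.+1, iter k par i == j].

Definition hbit (n : nat) (d : nat -> bool) (i : nat) : bool :=
  \big[addb/false]_(1 <= j < n | on_path j i) d j.

Definition MM (p : nat) (a : int) : bool :=
  ~~ ((a %% (p%:Z))%Z <= ((p.-1 %/ 2)%N)%:Z).

(* z = (d, x): d_i = z_{i-1}, x_i = z_{n-1+i-1}, for i = 1..n-1 *)
Definition dpart (n : nat) (z : {ffun 'I_(2 * n - 2) -> bool}) (i : nat) : bool :=
  zbit z i.-1.
Definition xpart (n : nat) (z : {ffun 'I_(2 * n - 2) -> bool}) (i : nat) : bool :=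
  zbit z (n.-1 + i.-1).

Definition pmmajmod (n p : nat) (z : {ffun 'I_(2 * n - 2) -> bool}) : bool :=
  let h := hbit n (dpart z) in
  let S : int := \sum_(1 <= i < n) ((xpart z i : nat)%:Z * (-1) ^+ (h i : nat)) in
  let parity := \big[addb/false]_(1 <= i < n) xpart z i in
  MM p S (+) parity.

Definition pm_ext (n p : nat) (z : {ffun 'I_(2 * n - 2) -> bool}) :
  {ffun 'I_((2 * n - 2).+1) -> bool} :=
  [ffun i : 'I_((2 * n - 2).+1) =>
     if (i < 2 * n - 2)%N then zbit z i else @pmmajmod n p z].

Definition is_local (R : realType) (l m : nat)
    (f : {ffun 'I_l -> bool} -> {ffun 'I_m -> bool}) (d : R) : Prop :=
  forall j : 'I_m, exists S : {set 'I_l},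
    (#|S|%:R <= d) /\
    (forall u v : {ffun 'I_l -> bool}, (forall i, i \in S -> u i = v i) -> f u j = f v j).

Definition pr_push (R : realType) (A B : finType) (g : A -> B) (T : {set B}) : R :=
  #|[set a | g a \in T]|%:R / #|A|%:R.

Definition tvd (R : realType) (A1 A2 B : finType) (g1 : A1 -> B) (g2 : A2 -> B) : R :=
  \big[Num.max/0]_(T : {set B}) `|pr_push R g1 T - pr_push R g2 T|.

Arguments pm_ext : clear implicits.

(* Main.v *)
Require Import Defs.
From HB Require Import structures.
From mathcomp Require Import all_boot all_order all_algebra.
From mathcomp Require Import reals sequences exp.
From mathcomp Require Import zify ring lra.
Import Order.TTheory GRing.Theory Num.Theory.
Local Open Scope ring_scope.
Set Implicit Arguments. Unset Strict Implicit. Unset Printing Implicit Defensive.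

(** Pass from [(d, x)] to the labels [(h(d)_i, x_i)], a bijection under which
  the target is uniform labels together with a function of the signed sum [s]
  of the labels: since [parity(x)] is the parity of [s], the last bit has sign
  [(-1)^s G(s mod p)] with [G] the sign of [MM_p].

  Let the locality be [D]. Fixing the inputs read by the top [n/(16D)] vertices
  of the tree fixes [h] there and leaves subtrees of size [O(D)], each reading
  [O(D^2)] inputs. A maximal set [Y] of low-degree inputs no two of which are
  read by the same subtree has [n/O(D^3)] elements; once the inputs outside [Y]
  are fixed, the input [j] in [Y] controls its own block of [O(D^2)] labels and
  nothing else, and the last output bit is constant. The distinguisher accepts
  an output if one of the following holds.
  - It is produced by some setting outside [Y] for which [t] blocks do not
    react to their input: at most [2^(l-t)] outputs are of this kind.
  - At most [2t] blocks have all labels [(0, 1)]: under uniform labels this is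
    unlikely by Chebyshev's inequality, as a block has that pattern with
    probability [4^(-O(D^2))], a small negative power of [N].
  - Its last bit is wrong.
  The pattern [(0, 1)] is the only one maximising the sum over a block, so a
  block that reacts without changing its sum never shows it. Hence if the first
  two conditions fail then [t] blocks change the sum by a nonzero amount mod
  [p], the sum mixes mod [p], and the last bit is wrong with probability at
  least [1/2 - O(1/p)]. *)

(** * Mixing of signed sums modulo p *)

Section Mixing.
Variable R : realFieldType.

(** The variance identity. Positivity of its left side is Cauchy-Schwarz against the constant 1; for
    mean-zero [a] it turns bounds on differences into bounds on the norm. *)
Lemma sum_sqr_diff (T : finType) (a : T -> R) :
  \sum_x \sum_y (a x - a y) ^+ 2 =
  2 * #|T|%:R * \sum_x a x ^+ 2 - 2 * (\sum_x a x) ^+ 2.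
Proof.
have E x : \sum_y (a x - a y) ^+ 2 =
    #|T|%:R * a x ^+ 2 - 2 * a x * (\sum_y a y) + \sum_y a y ^+ 2.
  rewrite (eq_bigr (fun y => a x ^+ 2 + (- 2 * a x * a y + a y ^+ 2))); last first.
    by move=> y _; ring.
  rewrite !big_split /= sumr_const -mulr_sumr -mulr_natl; ring.
rewrite (eq_bigr _ (fun x _ => E x)) !big_split /= sumr_const -mulr_sumr.
rewrite -[X in _ + X]mulr_natl sumrN -mulr_suml -mulr_sumr; ring.
Qed.

Lemma sqr_sum_le (T : finType) (a : T -> R) :
  (\sum_x a x) ^+ 2 <= #|T|%:R * \sum_x a x ^+ 2.
Proof.
have := sum_sqr_diff a.
have : 0 <= \sum_x \sum_y (a x - a y) ^+ 2.
  by apply: sumr_ge0 => x _; apply: sumr_ge0 => y _; apply: sqr_ge0.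
lra.
Qed.

Variable p : nat.
Hypothesis p_pr : prime p.
Local Notation Fp := 'F_p.

Lemma sum_shift (H : Fp -> R) d : \sum_y H (y + d) = \sum_y H y.
Proof. by rewrite [RHS](reindex_inj (addIr d)). Qed.

Lemma sum_const_Fp (c : R) : \sum_(x : Fp) c = p%:R * c.
Proof. by rewrite sumr_const card_Fp // mulr_natl. Qed.

Lemma sum_orbit (H : Fp -> R) x d : d != 0 ->
  \sum_(0 <= k < p) H (x + k%:R * d) = \sum_y H y.
Proof.
move=> d0; rewrite -[X in \sum_(0 <= k < X) _](Fp_cast p_pr) big_mkord.
rewrite (eq_bigr (fun k : Fp => H (k * d + x))); last first.
  by move=> k _; rewrite natr_Zp addrC.
rewrite -(sum_shift H x).
by rewrite [RHS](reindex_inj (mulIf d0)).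
Qed.

(** Walking from [y] to [x] in steps of [d] takes fewer than [p] steps and visits no residue
    twice. *)
Lemma Fp_diff_le_sum (G : Fp -> R) x y d : d != 0 ->
  `|G x - G y| <= \sum_z `|G (z + d) - G z|.
Proof.
move=> d0; set K := nat_of_ord ((x - y) / d).
have KE : y + K%:R * d = x by rewrite natr_Zp divfK // addrC subrK.
have Kp : (K <= p)%N.
  by apply: ltnW; rewrite /K -[X in (_ < X)%N](Fp_cast p_pr) ltn_ord.
have -> : G x - G y =
    \sum_(0 <= k < K) (G (y + k%:R * d + d) - G (y + k%:R * d)).
  rewrite -[in LHS]KE -[X in _ - G X]addr0 -[X in _ - G (_ + X)](mul0r d).
  rewrite (telescope_sumr_eq (fun k => G (y + k%:R * d))) //.
  by move=> k _; rewrite -natr1 mulrDl mul1r addrA.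
apply: le_trans (ler_norm_sum _ _ _) _.
rewrite -(sum_orbit (fun z => `|G (z + d) - G z|) y d0).
by rewrite [leRHS](big_cat_nat _ Kp) //= lerDl sumr_ge0.
Qed.

(** A Poincaré inequality on the cycle generated by [d]: each of the [p ^ 2] squared differences is
    at most [p] times the sum on the right, and for mean-zero [G] they add up to [2 * p] times the
    squared norm. *)
Lemma poincare_plus (G : Fp -> R) d : d != 0 -> \sum_x G x = 0 ->
  2 * \sum_x G x ^+ 2 <= p%:R ^+ 2 * \sum_x (G (x + d) - G x) ^+ 2.
Proof.
move=> d0 G0; have := sum_sqr_diff G; rewrite G0 expr0n /= mulr0 subr0 card_Fp //.
set D := \sum_x (G (x + d) - G x) ^+ 2 => E.
have B x y : (G x - G y) ^+ 2 <= p%:R * D.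
  have := sqr_sum_le (fun z => `|G (z + d) - G z|).
  rewrite card_Fp // [X in _ <= _ * X](eq_bigr (fun z => (G (z + d) - G z) ^+ 2)); last first.
    by move=> z _; rewrite real_normK ?num_real.
  apply: le_trans; rewrite -[leLHS]real_normK ?num_real //.
  by rewrite lerXn2r ?nnegrE ?sumr_ge0 // Fp_diff_le_sum.
have : \sum_x \sum_y (G x - G y) ^+ 2 <= p%:R * (p%:R * (p%:R * D)).
  apply: (@le_trans _ _ (\sum_(x : Fp) \sum_(y : Fp) p%:R * D)).
    by apply: ler_sum => x _; apply: ler_sum => y _.
  by rewrite !sum_const_Fp.
rewrite E -mulrA mulrCA ler_pM2l ?ltr0n ?prime_gt0 //.
by rewrite mulrA -expr2.
Qed.

Hypothesis p_odd : odd p.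

(* As [p] is odd, the alternating sum of [G (x + d) + G x] around the cycle
   telescopes to [2 * G x]. *)
Lemma poincare_minus (G : Fp -> R) d : d != 0 ->
  4 * \sum_x G x ^+ 2 <= p%:R ^+ 2 * \sum_x (G (x + d) + G x) ^+ 2.
Proof.
move=> d0; set H := fun x => G (x + d) + G x; set S := \sum_x _ ^+ 2.
set D := \sum_x (G (x + d) + G x) ^+ 2.
have B x : 4 * G x ^+ 2 <= p%:R * D.
  have E : 2 * G x = \sum_(0 <= k < p) (-1) ^+ k * H (x + k%:R * d).
    pose F k := - ((-1) ^+ k * G (x + k%:R * d)).
    rewrite (telescope_sumr_eq F) //.
      rewrite /F pchar_Fp_0 // mul0r addr0 -signr_odd p_odd; ring.
    by move=> k _; rewrite /F /H -natr1 mulrDl mul1r addrA exprS; ring.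
  have -> : 4 * G x ^+ 2 = `|2 * G x| ^+ 2.
    by rewrite real_normK ?num_real //; ring.
  have := sqr_sum_le (fun z => `|H z|).
  rewrite card_Fp // [X in _ <= _ * X](eq_bigr (fun z => (G (z + d) + G z) ^+ 2)); last first.
    by move=> z _; rewrite real_normK ?num_real.
  apply: le_trans; rewrite lerXn2r ?nnegrE ?sumr_ge0 // E.
  apply: le_trans (ler_norm_sum _ _ _) _.
  rewrite -(sum_orbit (fun z => `|H z|) x d0).
  by apply: ler_sum => k _; rewrite normrM normrX normrN1 expr1n mul1r.
apply: (@le_trans _ _ (\sum_(x : Fp) p%:R * D)).
  by rewrite mulr_sumr; apply: ler_sum.
by rewrite sum_const_Fp mulrA expr2.
Qed.

Lemma sum_sqr_comb (G : Fp -> R) d (u v : R) :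
  \sum_x (u * G x + v * G (x + d)) ^+ 2 =
  (u ^+ 2 + v ^+ 2) * \sum_x G x ^+ 2 + 2 * u * v * \sum_x G x * G (x + d).
Proof.
rewrite (eq_bigr (fun x => u ^+ 2 * G x ^+ 2 +
   (v ^+ 2 * G (x + d) ^+ 2 + 2 * u * v * (G x * G (x + d))))); last first.
  by move=> x _; ring.
rewrite !big_split /= -!mulr_sumr (sum_shift (fun x => G x ^+ 2)); ring.
Qed.

(** By the parallelogram law the half-sum and half-difference of two translates have squared norms
    adding up to that of [G]. For [a != b] a Poincaré inequality bounds the complementary half from
    below; the weaker one, [poincare_plus], sets the rate. *)
Lemma l2_contract (G : Fp -> R) (e : bool) a b : \sum_x G x = 0 ->
  \sum_x ((G (x + a) + (-1) ^+ e * G (x + b)) / 2) ^+ 2 <=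
  (1 - (a != b)%:R / (2 * p%:R ^+ 2)) * \sum_x G x ^+ 2.
Proof.
move=> G0; set d := b - a.
have -> : \sum_x ((G (x + a) + (-1) ^+ e * G (x + b)) / 2) ^+ 2 =
   \sum_x (2^-1 * G x + (-1) ^+ e / 2 * G (x + d)) ^+ 2.
  rewrite -[RHS](sum_shift _ a); apply: eq_bigr => x _.
  by rewrite /d (addrC b) addrA addrK; congr (_ ^+ 2); ring.
rewrite sum_sqr_comb; set A := \sum_x _ ^+ 2; set B := \sum_x _ * _.
have A0 : 0 <= A by apply: sumr_ge0 => x _; apply: sqr_ge0.
(* Both signs together give [|B| <= A], which settles the case [a = b]. *)
have S u : u = 1 \/ u = -1 -> 0 <= 2 * A + 2 * u * B.
  move=> hu; have <- : \sum_x (1 * G x + u * G (x + d)) ^+ 2 = 2 * A + 2 * u * B.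
    by rewrite sum_sqr_comb -/A -/B; case: hu => ->; ring.
  by apply: sumr_ge0 => x _; apply: sqr_ge0.
have p0 : 0 < p%:R ^+ 2 :> R by rewrite exprn_gt0 // ltr0n prime_gt0.
case: eqVneq => [_|ab] /=.
  by have := S 1 (or_introl erefl); have := S (-1) (or_intror erefl);
    case: e => /=; rewrite ?expr0 ?expr1; lra.
have d0 : d != 0 by rewrite subr_eq0 eq_sym.
have k : A / (2 * p%:R ^+ 2) * (2 * p%:R ^+ 2) = A.
  by rewrite divfK // mulf_neq0 // ?gt_eqF // ltr0n.
rewrite mulrBl mul1r mulrAC mul1r.
set q := A / _ in k *.
have hq : p%:R ^+ 2 * (2 * q) = A by rewrite -[RHS]k; ring.
case: e => /=; rewrite ?expr0 ?expr1.
- have := @poincare_minus G d d0.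
  rewrite [X in _ <= _ * X](eq_bigr (fun x => (1 * G x + 1 * G (x + d)) ^+ 2)); last first.
    by move=> x _; congr (_ ^+ 2); ring.
  rewrite sum_sqr_comb -/A -/B -[leLHS]/(4 * A) -{1}hq mulrCA ler_pM2l //.
  have : 0 <= q by rewrite divr_ge0 // mulr_ge0 // ltW.
  rewrite [_^-1 * A]mulrC -/q; lra.
- have := @poincare_plus G d d0 G0.
  rewrite [X in _ <= _ * X](eq_bigr (fun x => (-1 * G x + 1 * G (x + d)) ^+ 2)); last first.
    by move=> x _; congr (_ ^+ 2); ring.
  rewrite sum_sqr_comb -/A -/B -[leLHS]/(2 * A) -{1}hq mulrCA ler_pM2l //.
  rewrite [_^-1 * A]mulrC -/q; lra.
Qed.

(** Tracks the parity of [s] and its residue mod [p] at once. Averaging over two integer shifts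
    preserves this form and treats [c] and a mean-zero [G] separately. *)
Definition twist (c : R) (G : Fp -> R) (s : int) : R :=
  (-1) ^ s * (c + G s%:~R).

Lemma signz_bool (s : int) : exists e : bool, (-1) ^ s = (-1) ^+ e :> R.
Proof.
case: s => k; first by exists (odd k); rewrite signr_odd.
exists (odd k.+1); rewrite signr_odd /exprz /=.
by rewrite -exprVn invrN invr1.
Qed.

Lemma norm_signz (s : int) : `|(-1) ^ s : R| = 1.
Proof. by have [e ->] := signz_bool s; rewrite normr_sign. Qed.

(** With [e] the parity of [b - a], the constant keeps its modulus or cancels, and [G] becomes, up
    to sign, the average treated in [l2_contract]. *)
Lemma twist_avg c (G : Fp -> R) a b : \sum_x G x = 0 ->
  exists c' G', [/\ `|c'| <= `|c|, \sum_x G' x = 0,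
    \sum_x G' x ^+ 2 <=
      (1 - (a%:~R != b%:~R :> Fp)%:R / (2 * p%:R ^+ 2)) * \sum_x G x ^+ 2 &
    forall s, (twist c G (s + a) + twist c G (s + b)) / 2 = twist c' G' s].
Proof.
move=> G0; have [e he] := signz_bool (b - a).
have m1 : -1 != 0 :> R by rewrite oppr_eq0 oner_eq0.
exists ((-1) ^ a * ((1 + (-1) ^+ e) / 2) * c).
exists (fun x => (-1) ^ a * ((G (x + a%:~R) + (-1) ^+ e * G (x + b%:~R)) / 2)).
split.
- rewrite !normrM norm_signz mul1r.
  rewrite -[leRHS]mul1r ler_wpM2r // -normrM ler_norml.
  by case: e {he} => /=; rewrite ?expr1 ?expr0; apply/andP; split; lra.
- rewrite -mulr_sumr -mulr_suml big_split /= -mulr_sumr.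
  by rewrite !(sum_shift G) G0 mulr0 addr0 mul0r mulr0.
- apply: le_trans (@l2_contract G e a%:~R b%:~R G0).
  apply: ler_sum => x _; rewrite exprMn.
  by rewrite -[X in X * _]real_normK ?num_real // norm_signz expr1n mul1r.
move=> s; rewrite /twist !rmorphD /=.
have -> : (-1) ^ (s + b) = (-1) ^ s * (-1) ^ a * (-1) ^+ e :> R.
  by rewrite -he -!expfzDr //; congr (_ ^ _); lia.
rewrite expfzDr //; set E := (-1) ^+ e; ring.
Qed.

(** The bits [y j] are averaged out one at a time by [twist_avg]; each [j] with [a j] and [b j]
    distinct mod [p] contracts the norm of [G]. At the end the norm bounds every single value. *)
Lemma cube_mixing (I : finType) (r : seq I) (a b : I -> int) c (G : Fp -> R) s eta :
  uniq r -> \sum_x G x = 0 -> 0 <= eta ->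
  (1 - (2 * p%:R ^+ 2)^-1) ^+ (count (fun j => (a j)%:~R != (b j)%:~R :> Fp) r) *
    \sum_x G x ^+ 2 <= eta ^+ 2 ->
  `|\sum_(y : {ffun I -> bool})
      twist c G (s + \sum_(j <- r) (if y j then b j else a j))|
    <= (2 ^ #|I|)%N%:R * (`|c| + eta).
Proof.
have r1 : 0 <= 1 - (2 * p%:R ^+ 2)^-1 :> R.
  rewrite subr_ge0 invf_le1; last by rewrite mulr_gt0 // exprn_gt0 // ltr0n prime_gt0.
  rewrite -natrX -natrM ler1n muln_gt0 /= expn_gt0 prime_gt0 //.
elim: r c G s => [|j r IH] c G s /=.
  move=> _ G0 eta0; rewrite expr0 mul1r => GE.
  under eq_bigr do rewrite big_nil addr0.
  rewrite sumr_const card_ffun card_bool -[X in `|X|]mulr_natl normrM.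
  rewrite ger0_norm ?ler0n // ler_wpM2l ?ler0n //.
  rewrite /twist normrM norm_signz mul1r.
  apply: le_trans (ler_normD _ _) _; rewrite lerD2l.
  rewrite -ler_sqr ?nnegrE // real_normK ?num_real //.
  apply: le_trans GE; rewrite (bigD1 s%:~R) //= lerDl.
  by apply: sumr_ge0 => x _; apply: sqr_ge0.
move=> /andP[jr ur] G0 eta0 GE.
have [c' [G' [cc' G'0 GG' TE]]] := @twist_avg c G (a j) (b j) G0.
(* Pairing each [y] with its flip at [j] turns the sum into an average over both values of [y j]. *)
pose flip (y : {ffun I -> bool}) := [ffun i => y i (+) (i == j)].
have flipK : involutive flip.
  by move=> y; apply/ffunP => i; rewrite !ffunE -addbA addbb addbF.
have E : \sum_(y : {ffun I -> bool})
      twist c G (s + \sum_(i <- j :: r) (if y i then b i else a i)) =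
    \sum_(y : {ffun I -> bool})
      twist c' G' (s + \sum_(i <- r) (if y i then b i else a i)).
  have two x y z : x = z -> y = z -> x = (x + y) / 2 :> R by move=> -> ->; lra.
  set L := LHS.
  have L2 : L = \sum_(y : {ffun I -> bool})
      twist c G (s + \sum_(i <- j :: r) (if flip y i then b i else a i)).
    by rewrite /L (reindex_inj (inv_inj flipK)).
  rewrite (two L _ L (erefl _) (esym L2)) -big_split /= mulr_suml.
  apply: eq_bigr => y _; rewrite -TE !big_cons.
  have -> : \sum_(i <- r) (if flip y i then b i else a i) =
            \sum_(i <- r) (if y i then b i else a i).
    apply: eq_big_seq => i ir; rewrite ffunE.
    by case: eqP => [ij|]; [rewrite -ij ir in jr | rewrite addbF].
  rewrite ffunE eqxx addbT; congr (_ / 2).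
  by case: (y j) => /=; rewrite ![s + (_ + _)]addrCA ![_ + (s + _)]addrC // [LHS]addrC.
rewrite E; apply: le_trans (IH c' G' s ur G'0 eta0 _) _; last first.
  by rewrite ler_wpM2l ?ler0n // lerD2r.
apply: le_trans GE; set m := count _ r; set u := _ != _.
rewrite exprD mulrAC [leRHS]mulrC ler_wpM2l ?exprn_ge0 //.
apply: le_trans GG' _; rewrite -/u mulrC [leRHS]mulrC ler_wpM2l //.
  by apply: sumr_ge0 => x _; apply: sqr_ge0.
by case: u; rewrite ?expr0 ?expr1 ?mul1r ?mul0r ?subr0.
Qed.

End Mixing.

(** * The sign of [MM] on residues *)

Section MajMod.
Variables (R : realFieldType) (p : nat).
Hypotheses (p_pr : prime p) (p_odd : odd p).

Definition maj_sign (y : 'F_p) : R := (-1) ^+ (p.-1 %/ 2 < y)%N.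

(** There are [(p + 1) / 2] residues of sign 1 and [(p - 1) / 2] of sign -1. *)
Lemma sum_maj_sign : \sum_y maj_sign y = 1.
Proof.
pose F (k : nat) : R := (-1) ^+ (p.-1 %/ 2 < k)%N.
have -> : \sum_y maj_sign y = \sum_(0 <= k < p) F k.
  by rewrite -[X in \sum_(0 <= k < X) _](Fp_cast p_pr) big_mkord.
set m := (p.-1 %/ 2)%N; have pE : p = (m.+1 + m)%N by rewrite /m; lia.
rewrite (@big_cat_nat _ _ _ m.+1) /=; [|lia|lia].
rewrite (@eq_big_nat _ _ _ 0%N m.+1 _ (fun=> 1)); last first.
  by move=> k /andP[_ km]; rewrite /F -/m ltnNge -ltnS km.
rewrite (@eq_big_nat _ _ _ m.+1 p _ (fun=> -1)); last first.
  by move=> k /andP[km _]; rewrite /F -/m km expr1.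
rewrite !sumr_const_nat pE addKn subn0 -natr1 mulNrn; ring.
Qed.

Lemma MM_Fp (s : int) : MM p s = (p.-1 %/ 2 < (s%:~R : 'F_p)%R)%N.
Proof.
have p0 : (p%:Z != 0) by have := prime_gt0 p_pr; lia.
have [k kE] : exists k : nat, (s %% p)%Z = k%:Z.
  by have := modz_ge0 s p0; case: (s %% p)%Z => // k _; exists k.
have kp : (k < p)%N.
  have := ltz_pmod s (_ : 0 < p%:Z); rewrite kE ltz_nat; apply.
  by rewrite ltz_nat prime_gt0.
have -> : s%:~R = k%:R :> 'F_p.
  rewrite (divz_eq s p) kE rmorphD rmorphM /=.
  by rewrite -[X in _ * X + _]/(p%:R) pchar_Fp_0 // mulr0 add0r.
by rewrite /MM kE lez_nat -ltnNge /= val_Fp_nat // modn_small.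
Qed.

(** The mean [1 / p] is split off because mixing needs mean zero; it becomes the constant [c] of
    [twist]. *)
Definition maj_dev (y : 'F_p) : R := maj_sign y - p%:R^-1.

Lemma sum_maj_dev : \sum_y maj_dev y = 0.
Proof.
rewrite big_split /= sum_maj_sign (sum_const_Fp p_pr) mulrN mulfV ?subrr //.
by rewrite pnatr_eq0 -lt0n prime_gt0.
Qed.

Lemma sum_maj_dev_sqr : \sum_y maj_dev y ^+ 2 <= p%:R.
Proof.
have p0 : p%:R != 0 :> R by rewrite pnatr_eq0 -lt0n prime_gt0.
have E y : maj_dev y ^+ 2 = 1 + p%:R^-1 ^+ 2 - 2 * p%:R^-1 * maj_sign y.
  by rewrite /maj_dev /maj_sign; case: (_ < _)%N; rewrite ?expr1 ?expr0; ring.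
rewrite (eq_bigr _ (fun y _ => E y)) big_split /= sumrN -mulr_sumr.
rewrite sum_maj_sign (sum_const_Fp p_pr) mulrDr mulr1.
rewrite expr2 mulrA mulfV // mul1r mulr1.
have : 0 <= p%:R^-1 :> R by rewrite invr_ge0 ler0n.
lra.
Qed.

Lemma twist_MM (s : int) :
  twist p%:R^-1 maj_dev s = (-1) ^ s * (-1) ^+ MM p s.
Proof. by rewrite /twist /maj_dev addrC subrK MM_Fp. Qed.

End MajMod.

Lemma sum_bool_card (R : pzSemiRingType) (T : finType) (P : pred T) :
  \sum_x (P x)%:R = #|[set x | P x]|%:R :> R.
Proof. by rewrite -natr_sum -sum1dep_card [in RHS]big_mkcond; congr _%:R. Qed.

(** * Splicing inputs and rare patterns *)

Section Cube.
Variables (R : realFieldType) (I : finType).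
Local Notation cube := {ffun I -> bool}.

Definition splice (Y : {set I}) (u y : cube) : cube :=
  [ffun i => if i \in Y then y i else u i].

(** Exchanging the coordinates in [Y] is an involution on pairs [(u, y)], so resampling [Y] keeps
    the input uniform. *)
Lemma sum_splice (Y : {set I}) (phi : cube -> R) :
  \sum_u \sum_y phi (splice Y u y) = (2 ^ #|I|)%N%:R * \sum_u phi u.
Proof.
pose g (z : cube * cube) := (splice Y z.1 z.2, splice Y z.2 z.1).
have gK : involutive g.
  case=> u y; rewrite /g /=; congr pair; apply/ffunP => i;
  by rewrite !ffunE; case: (i \in Y).
rewrite pair_bigA /= (reindex_inj (inv_inj gK)) /=.
rewrite (eq_bigr (fun z : cube * cube => phi z.1)); last first.
  by move=> z _; rewrite -[splice _ _ _]/((g (g z)).1) gK.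
rewrite -(pair_bigA _ (fun u _ => phi u)) /= mulr_sumr.
by apply: eq_bigr => u _; rewrite sumr_const card_ffun card_bool mulr_natl.
Qed.

End Cube.

Section Pattern.
Variables (V I C : finType) (c0 : C).
Local Notation lab := {ffun V -> C}.

Definition has_pat (A : {set V}) (L : lab) := [forall (v | v \in A), L v == c0].

Lemma card_has_pat (A : {set V}) :
  #|[set L | has_pat A L]| = (#|C| ^ (#|V| - #|A|))%N.
Proof.
have -> : (#|V| - #|A|)%N = #|~: A| by rewrite -(cardsC A) addKn.
rewrite -(card_pffun_on c0 (mem (~: A)) predT) cardsE.
apply: eq_card => L; apply/forall_inP/pffun_onP => [h|[/subsetP h _] v vA].
  split; last by move=> x _.
  apply/subsetP => v; rewrite !inE; apply: contra => vA.
  exact: h.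
have := h v; rewrite !inE vA /=; case: eqP => // _ H; by have := H isT.
Qed.

Lemma has_patU (A B : {set V}) L : has_pat (A :|: B) L = has_pat A L && has_pat B L.
Proof.
apply/forall_inP/andP => [h|[/forall_inP hA /forall_inP hB] v].
  by split; apply/forall_inP => v vA; apply: h; rewrite inE vA ?orbT.
by rewrite inE => /orP[/hA|/hB].
Qed.

Variables (R : realFieldType) (Y : {set I}) (blk : I -> {set V}).
Hypothesis dis : forall i j, i != j -> [disjoint blk i & blk j].

Definition patcount (L : lab) := #|[set j in Y | has_pat (blk j) L]|.

(** Chebyshev: disjoint blocks show the pattern independently, so the variance is at most the mean
    [mu]. As [mu >= 4 * t], a count of at most [2 * t] deviates by at least [mu / 2]. *)
Lemma patcount_rare (K t : nat) : (0 < t)%N -> (0 < #|C|)%N ->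
  (forall j, j \in Y -> #|blk j| <= K)%N -> (4 * t * #|C| ^ K <= #|Y|)%N ->
  #|[set L | (patcount L <= 2 * t)%N]|%:R <= (#|C| ^ #|V|)%N%:R / t%:R :> R.
Proof.
move=> t0 C0 hK hY.
pose q (A : {set V}) : R := ((#|C| ^ #|A|)%N%:R)^-1.
have Cr0 k : 0 < (#|C| ^ k)%N%:R :> R by rewrite ltr0n expn_gt0 C0.
have q0 A : 0 <= q A by rewrite invr_ge0 ltW.
set M := (#|C| ^ #|V|)%N%:R : R.
have cnt A : \sum_(L : lab) (has_pat A L)%:R = M * q A.
  rewrite sum_bool_card card_has_pat /M /q.
  apply/(canRL (mulfK _)); first by rewrite gt_eqF.
  by rewrite -natrM -expnD subnK // max_card.
pose X (L : lab) : R := \sum_(j in Y) (has_pat (blk j) L)%:R.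
have XE L : X L = (patcount L)%:R.
  rewrite /X /patcount -sum_bool_card big_mkcond /=.
  by apply: eq_bigr => j _; case: (j \in Y).
pose mu : R := \sum_(j in Y) q (blk j).
have EX : \sum_L X L = M * mu.
  rewrite exchange_big /= mulr_sumr; apply: eq_bigr => j _; exact: cnt.
have EX2 : \sum_L X L ^+ 2 <= M * (mu ^+ 2 + mu).
  have -> : \sum_L X L ^+ 2 =
      \sum_(i in Y) \sum_(j in Y) \sum_L (has_pat (blk i :|: blk j) L)%:R.
    rewrite (eq_bigr (fun L => \sum_(i in Y) \sum_(j in Y)
        (has_pat (blk i :|: blk j) L)%:R)); last first.
      move=> L _; rewrite expr2 mulr_suml; apply: eq_bigr => i _.
      rewrite mulr_sumr; apply: eq_bigr => j _.
      by rewrite has_patU -natrM mulnb.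
    rewrite exchange_big; apply: eq_bigr => i _; exact: exchange_big.
  have -> : mu ^+ 2 + mu = \sum_(i in Y) (\sum_(j in Y) q (blk i) * q (blk j) + q (blk i)).
    rewrite big_split /= -/mu expr2 mulr_suml; congr (_ + _).
    by apply: eq_bigr => i _; rewrite mulr_sumr.
  rewrite mulr_sumr; apply: ler_sum => i iY.
  (* The diagonal term gives the share of [i] in [mu]; the others factor because the blocks are
     disjoint. *)
  rewrite (bigD1 i) //= (bigD1 (P := mem Y) i) //= setUid cnt.
  set S1 := (X in _ + X <= _); set S2 := (X in _ + X + _).
  have q2 := mulr_ge0 (ltW (Cr0 #|V|)) (mulr_ge0 (q0 (blk i)) (q0 (blk i))).
  rewrite -/M in q2.
  suff : S1 <= M * S2 by lra.
  rewrite mulr_sumr; apply: ler_sum => j /andP[jY ji].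
  rewrite cnt /q -invfM -natrM -expnD.
  have d : blk i :&: blk j = set0 by apply: disjoint_setI0; rewrite dis // eq_sym.
  by rewrite cardsU d cards0 subn0.
have var : \sum_L (X L - mu) ^+ 2 <= M * mu.
  rewrite (eq_bigr (fun L => X L ^+ 2 + (- (2 * mu) * X L + mu ^+ 2))); last first.
    by move=> L _; ring.
  rewrite !big_split /= -mulr_sumr EX sumr_const card_ffun -/M -mulr_natl -/M.
  lra.
have mut : 4 * t%:R <= mu.
  apply: (@le_trans _ _ (\sum_(j in Y) ((#|C| ^ K)%N%:R)^-1)); last first.
    apply: ler_sum => j jY; rewrite /q lef_pV2 ?posrE // ler_nat.
    by apply: leq_pexp2l => //; apply: hK.
  by rewrite sumr_const -[leRHS]mulr_natl ler_pdivlMr // -!natrM ler_nat.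
have tr : 0 < t%:R :> R by rewrite ltr0n.
have M0 : 0 < M := Cr0 _.
rewrite ler_pdivlMr //.
set bad := [set L | _]; set b := #|bad|%:R.
have bad_le : b * (mu / 2) ^+ 2 <= M * mu.
  apply: le_trans var.
  rewrite (bigID (fun L => L \in bad)) /= ler_wpDr //.
    by apply: sumr_ge0 => L _; apply: sqr_ge0.
  rewrite /b mulr_natl -sumr_const; apply: ler_sum => L.
  rewrite inE XE => hL.
  have {}hL : (patcount L)%:R <= 2 * t%:R :> R by rewrite -natrM ler_nat.
  rewrite -[leRHS]sqrrN lerXn2r ?nnegrE; lra.
have mu0 : 0 < mu by lra.
have : b * mu <= 4 * M.
  rewrite -(ler_pM2r mu0).
  have -> : b * mu * mu = 4 * (b * (mu / 2) ^+ 2) by field.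
  lra.
have : 0 <= b by rewrite ler0n.
nra.
Qed.
End Pattern.

(** * Block structures *)

Section Labels.
Variables (V : finType) (p : nat).

Definition lval (c : bool * bool) : int := (c.2 : nat)%:Z * (-1) ^+ (c.1 : nat).

Definition lsum (L : {ffun V -> bool * bool}) : int := \sum_v lval (L v).

Definition lfun (L : {ffun V -> bool * bool}) : bool :=
  MM p (lsum L) (+) \big[addb/false]_v (L v).2.

(** A label contributes an odd number to the sum exactly when its second bit is set. *)
Lemma lfun_sign (R : realFieldType) L :
  (-1) ^+ lfun L = (-1) ^ lsum L * (-1) ^+ MM p (lsum L) :> R.
Proof.
rewrite /lfun signr_addb mulrC; congr (_ * _).
rewrite (big_morph (fun c : bool => (-1) ^+ c : R) (id1 := 1) (op1 := *%R)) //; last first.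
  by move=> x y; rewrite signr_addb.
rewrite /lsum (big_morph (fun s : int => (-1) ^ s : R) (id1 := 1) (op1 := *%R)) //; last first.
  by move=> x y; rewrite expfzDr // oppr_eq0 oner_eq0.
apply: eq_bigr => v _; case: (L v) => [[] []]; rewrite /lval /= ?mul0r ?mul1r ?expr0z //.
by rewrite expr1 exprN1 invrN invr1.
Qed.

Lemma lval_le1 c : `|lval c| <= 1.
Proof. by case: c => [[] []]. Qed.

Lemma lval_eq1 c : 1 <= lval c -> c = (false, true).
Proof. by case: c => [[] []]. Qed.

End Labels.

Lemma intr_Fp_neq0 (p : nat) (d : int) : prime p -> d != 0 -> (`|d| < p)%N ->
  d%:~R != 0 :> 'F_p.
Proof.
move=> p_pr d0 dp.
have h (k : nat) : (0 < k < p)%N -> k%:R != 0 :> 'F_p.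
  move=> /andP[k0 kp]; rewrite -(dvdn_pcharf (pchar_Fp p_pr)) gtnNdvd //.
case: d d0 dp => k d0 dp; first by apply: h; move: d0 dp; lia.
by rewrite NegzE rmorphN oppr_eq0; apply: h; move: dp; lia.
Qed.

Section Blocks.
Variables (R : realType) (I V : finType) (p : nat).
Hypotheses (p_pr : prime p) (p_odd : odd p).
Local Notation cube := {ffun I -> bool}.
Local Notation lab := {ffun V -> bool * bool}.
(* Once the inputs outside [Y] are fixed, the label of [v] depends only on the
   input [own v], if any. *)
Variables (F : cube -> lab) (b : cube -> bool) (Y : {set I}) (own : V -> option I).
Hypothesis locF : forall v (u u' : cube),
  (forall i, i \notin Y \/ own v = Some i -> u i = u' i) -> F u v = F u' v.
Hypothesis locb : forall u u' : cube, (forall i, i \notin Y -> u i = u' i) -> b u = b u'.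

Definition blk (j : I) : {set V} := [set v | own v == Some j].

Lemma blk_disjoint i j : i != j -> [disjoint blk i & blk j].
Proof.
move=> ij; apply/pred0P => v /=; rewrite !inE.
by apply/negP => /andP[/eqP -> /eqP[E]]; rewrite E eqxx in ij.
Qed.

Definition upd (u : cube) (j : I) (c : bool) : cube :=
  [ffun i => if i == j then c else u i].

Definition wt (j : I) (u : cube) : int := \sum_(v in blk j) lval (F u v).

(** Since both values of input [j] are compared, this set and [moving] depend only on the inputs
    outside [Y]. *)
Definition fixed (u : cube) : {set I} :=
  [set j in Y | [forall (v | v \in blk j), F (upd u j true) v == F (upd u j false) v]].

Definition moving (u : cube) : {set I} :=
  [set j in Y | wt j (upd u j true) != wt j (upd u j false)].

Lemma F_upd_agree (u u' : cube) j c v : (forall i, i \notin Y -> u i = u' i) ->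
  v \in blk j -> F (upd u j c) v = F (upd u' j c) v.
Proof.
move=> uu'; rewrite inE => /eqP ov; apply: locF => i; rewrite !ffunE.
by case: eqP => // ij [/uu'//|]; rewrite ov => -[ji]; rewrite ji in ij.
Qed.

Lemma fixed_agree (u u' : cube) : (forall i, i \notin Y -> u i = u' i) -> fixed u = fixed u'.
Proof.
move=> uu'; apply/setP => j; rewrite !inE; congr (_ && _).
by apply: eq_forallb_in => v vj; rewrite !(F_upd_agree _ uu').
Qed.

Lemma moving_agree (u u' : cube) : (forall i, i \notin Y -> u i = u' i) -> moving u = moving u'.
Proof.
move=> uu'; apply/setP => j; rewrite !inE; congr (_ && (_ != _));
  by apply: eq_bigr => v vj; rewrite (F_upd_agree _ uu').
Qed.

Lemma splice_agree (u y : cube) i : i \notin Y -> splice Y u y i = u i.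
Proof. by move=> iY; rewrite ffunE (negbTE iY). Qed.

Lemma upd_id u j : upd u j (u j) = u.
Proof. by apply/ffunP => i; rewrite ffunE; case: eqP => [->|]. Qed.

(** If the block sum does not change, then both settings attain the maximum [#|blk j|], which forces
    every label to be [(false, true)] in both. *)
Lemma pat_fixed_moving u :
  [set j in Y | has_pat (false, true) (blk j) (F u)] \subset fixed u :|: moving u.
Proof.
apply/subsetP => j; rewrite !inE => /andP[-> /forall_inP hp] /=.
rewrite orbC -implybE; apply/implyP => /eqP wE.
have {}wE c : wt j (upd u j c) = wt j u.
  by rewrite -[in RHS](upd_id u j); case: (u j); case: c.
suff h c v : v \in blk j -> F (upd u j c) v = (false, true).
  by apply/forall_inP => v vj; rewrite !h.
move=> vj; apply: lval_eq1.
have E1 : wt j (upd u j c) = \sum_(v in blk j) 1.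
  by rewrite wE; apply: eq_bigr => w wj; rewrite (eqP (hp w wj)).
(* The slacks are nonnegative and add up to zero, so each vanishes. *)
have {E1} : \sum_(v in blk j) (1 - lval (F (upd u j c) v)) = 0.
  by rewrite sumrB -E1 subrr.
have nn w : 0 <= 1 - lval (F (upd u j c) w) by have := lval_le1 (F (upd u j c) w); lia.
move/eqP; rewrite psumr_eq0 // => /allP /(_ v); rewrite mem_index_enum vj => /(_ isT) /eqP; lia.
Qed.

(** Puts the signed sum in the form required by [cube_mixing]: a constant from the labels owned by
    no member of [Y], plus one of two values for each block. *)
Lemma lsum_splice u y : lsum (F (splice Y u y)) =
  \sum_(v | ~~ [exists (j | j \in Y), own v == Some j]) lval (F u v) +
  \sum_(j in Y) (if y j then wt j (upd u j true) else wt j (upd u j false)).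
Proof.
rewrite /lsum (bigID (fun v => ~~ [exists (j | j \in Y), own v == Some j])) /=;
  congr (_ + _).
  apply: eq_bigr => v hv; congr lval; apply: locF => i [iY|ov].
    by rewrite splice_agree.
  rewrite splice_agree //; apply: contra hv => iY.
  by apply/existsP; exists i; rewrite iY ov eqxx.
have -> : \sum_(j in Y) (if y j then wt j (upd u j true) else wt j (upd u j false)) =
    \sum_(j in Y) \sum_(v in blk j) lval (F (splice Y u y) v).
  apply: eq_bigr => j jY.
  have -> : (if y j then wt j (upd u j true) else wt j (upd u j false)) = wt j (upd u j (y j)).
    by case: (y j).
  apply: eq_bigr => v; rewrite inE => /eqP ov; congr lval; apply: locF => i; rewrite !ffunE ov.
  by case: eqP => [-> _|ij [/negbTE ->|[ji]]] //; [rewrite jY | rewrite ji in ij].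
rewrite [RHS](exchange_big_dep predT) //= big_mkcond /=; apply: eq_bigr => v _.
rewrite negbK; case: existsP => [[j /andP[jY /eqP ov]]|nex]; last first.
  rewrite big1 // => j; rewrite inE => /andP[jY ov]; case: nex; exists j; by rewrite jY.
rewrite (big_pred1 j) // => i; rewrite inE ov /=.
apply/andP/eqP => [[_ /eqP[->]]//|->]; split=> //.
Qed.

Variables (K t : nat).
Hypothesis hK : forall j, j \in Y -> (#|blk j| <= K)%N.
Hypothesis hp : (2 * K < p)%N.

Lemma wt_le j u : j \in Y -> `|wt j u| <= K%:Z.
Proof.
move=> jY; apply: le_trans (ler_norm_sum _ _ _) _.
apply: (@le_trans _ _ (\sum_(v in blk j) 1)).
  by apply: ler_sum => v _; apply: lval_le1.
by rewrite sumr_const natz lez_nat hK.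
Qed.

(** Two distinct block sums differ by at most [2 * K < p], hence stay distinct mod [p]. *)
Lemma moving_Fp u j : j \in moving u ->
  (wt j (upd u j false))%:~R != (wt j (upd u j true))%:~R :> 'F_p.
Proof.
rewrite inE => /andP[jY wn]; rewrite -subr_eq0 -rmorphB /= intr_Fp_neq0 //.
  by move: wn; lia.
have := wt_le (upd u j true) jY; have := wt_le (upd u j false) jY; lia.
Qed.

Definition unreactive : {set lab} := F @: [set u | (t <= #|fixed u|)%N].

Definition btest : {set lab * bool} :=
  [set z | [|| z.1 \in unreactive, (patcount (false, true) Y blk z.1 <= 2 * t)%N
             | z.2 != lfun p z.1]].

(* Flipping the inputs of fixed blocks does not change the output, so each
   point of [unreactive] has at least [2 ^ t] preimages. *)
Lemma card_unreactive : (#|unreactive| * 2 ^ t <= 2 ^ #|I|)%N.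
Proof.
have -> : (2 ^ #|I| = #|[set: cube]|)%N by rewrite cardsT card_ffun card_bool.
rewrite -sum_nat_const.
apply: (@leq_trans (\sum_(L in unreactive) #|[set u | F u == L]|)); last first.
  rewrite -sum1_card (partition_big F predT) //=.
  rewrite [leqRHS](bigID (mem unreactive)) /= -[leqLHS]addn0 leq_add //.
  apply: leq_sum => L _; rewrite -sum1_card; apply: eq_leq.
  by apply: eq_bigl => u; rewrite !inE.
apply: leq_sum => L /imsetP[u]; rewrite inE => tu ->.
apply: leq_trans (_ : #|powerset (fixed u)| <= _)%N; first by rewrite card_powerset leq_exp2l.
pose g (A : {set I}) : cube := [ffun i => u i (+) (i \in A)].
have gi : injective g.
  move=> A B /ffunP E; apply/setP => i; have := E i; rewrite !ffunE.
  by move/addbI.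
rewrite -(card_imset _ gi); apply: subset_leq_card; apply/subsetP => w.
case/imsetP => A; rewrite powersetE => /subsetP sA ->; rewrite inE; apply/eqP/ffunP => v.
case ov : (own v) => [j|]; last first.
  apply: locF => i [iY|]; rewrite ?ov // ffunE.
  case iA : (i \in A); last by rewrite addbF.
  by have := sA i iA; rewrite inE (negbTE iY).
have outA i : i \notin Y -> g A i = u i.
  move=> iY; rewrite ffunE; case iA : (i \in A); last by rewrite addbF.
  by have := sA i iA; rewrite inE (negbTE iY).
case jA : (j \in A); last first.
  by apply: locF => i [/outA//|]; rewrite ov => -[<-]; rewrite ffunE jA addbF.
have := sA j jA; rewrite inE => /andP[jY /forall_inP /(_ v)].
rewrite inE ov eqxx => /(_ isT) /eqP E.
have {}E c : F (upd u j c) v = F u v.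
  by rewrite -[in RHS](upd_id u j); case: (u j); case: c.
rewrite -[RHS](E (g A j)); apply: locF => i; rewrite ov [upd _ _ _ _]ffunE.
by case: eqP => [->//|ij [/outA//|[ji]]]; rewrite ji in ij.
Qed.

Hypothesis t0 : (0 < t)%N.
Hypothesis hY : (4 * t * 4 ^ K <= #|Y|)%N.

(** On the graph of [lfun] the last bit is right, so only the first two conditions of [btest] can
    hold. *)
Lemma card_btest_graph :
  #|[set L | (L, lfun p L) \in btest]|%:R <=
  (2 ^ #|I|)%N%:R / (2 ^ t)%N%:R + (4 ^ #|V|)%N%:R / t%:R :> R.
Proof.
have c4 : #|{: bool * bool}| = 4%N by rewrite card_prod card_bool.
apply: (@le_trans _ _ (#|unreactive|%:R +
   #|[set L | (patcount (false, true) Y blk L <= 2 * t)%N]|%:R)).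
  rewrite -natrD ler_nat; apply: leq_trans (leq_card_setU _ _).
  apply: subset_leq_card; apply/subsetP => L; rewrite !inE /= eqxx orbF.
  by [].
rewrite lerD //.
  rewrite ler_pdivlMr ?ltr0n ?expn_gt0 // -natrM ler_nat; exact: card_unreactive.
have := @patcount_rare V I _ (false, true) R Y blk blk_disjoint K t t0.
by rewrite c4; apply.
Qed.

(** The guessed bit is constant on the fiber, while the sign of [lfun] averages to at most
    [1 / p + eta] by [cube_mixing]. *)
Lemma mixed_fiber (eta : R) u : 0 <= eta ->
  (1 - (2 * p%:R ^+ 2)^-1) ^+ t * p%:R <= eta ^+ 2 -> (t <= #|moving u|)%N ->
  (2 ^ #|I|)%N%:R * (1 / 2 - (p%:R^-1 + eta) / 2) <=
  \sum_y (b (splice Y u y) != lfun p (F (splice Y u y)))%:R :> R.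
Proof.
move=> eta0 heta tm.
have r01 : 0 <= (1 - (2 * p%:R ^+ 2)^-1 : R) <= 1.
  have : (1 <= 2 * p ^ 2)%N by rewrite muln_gt0 expn_gt0 (prime_gt0 p_pr).
  rewrite -(ler_nat R) natrM natrX => h.
  by rewrite subr_ge0 gerBl invr_ge0 (le_trans ler01 h) invf_le1 ?h // (lt_le_trans ltr01 h).
pose s0 := \sum_(v | ~~ [exists (j | j \in Y), own v == Some j]) lval (F u v).
have := @cube_mixing R p p_pr p_odd I (enum Y) (fun j => wt j (upd u j false))
  (fun j => wt j (upd u j true)) p%:R^-1 (maj_dev R (p := p)) s0 eta (enum_uniq _)
  (sum_maj_dev R p_pr p_odd) eta0.
have -> : (\sum_(y : cube) twist p%:R^-1 (maj_dev R (p:=p)) (s0 +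
     \sum_(j <- enum Y) (if y j then wt j (upd u j true) else wt j (upd u j false))))
   = \sum_(y : cube) (-1) ^+ lfun p (F (splice Y u y)).
  by apply: eq_bigr => y _; rewrite big_enum lfun_sign lsum_splice twist_MM.
move=> H; have {H} : `|\sum_(y : cube) (-1) ^+ lfun p (F (splice Y u y))| <=
    (2 ^ #|I|)%N%:R * (p%:R^-1 + eta) :> R.
  rewrite -[X in X + eta]ger0_norm ?invr_ge0 ?ler0n //; apply: H.
  apply: le_trans heta; apply: ler_pM => //.
  - by apply: exprn_ge0; case/andP: r01.
  - by apply: sumr_ge0 => x _; apply: sqr_ge0.
  (* The base lies in [[0, 1]], and every moving input counts as a contraction, so the exponent may
     be lowered to [t]. *)
  - apply: ler_wiXn2l; [by case/andP: r01|by case/andP: r01|].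
    apply: leq_trans tm _; rewrite -size_filter cardE.
    apply: uniq_leq_size; first exact: enum_uniq.
    move=> j; rewrite mem_enum mem_filter mem_enum => jm.
    by rewrite moving_Fp //=; move: jm; rewrite inE => /andP[].
  - exact: sum_maj_dev_sqr.
set S' := \sum_y _; set S := \sum_y _ => hS.
have bE y : b (splice Y u y) = b u by apply: locb => i; apply: splice_agree.
have -> : S' = ((2 ^ #|I|)%N%:R - (-1) ^+ b u * S) / 2.
  rewrite /S mulr_sumr.
  have -> : (2 ^ #|I|)%N%:R = \sum_(y : cube) 1 :> R.
    by rewrite sumr_const card_ffun card_bool.
  rewrite -sumrB mulr_suml; apply: eq_bigr => y _; rewrite bE.
  by case: (b u); case: (lfun _ _); rewrite /= ?expr0 ?expr1; lra.
have : (-1) ^+ b u * S <= (2 ^ #|I|)%N%:R * (p%:R^-1 + eta).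
  by apply: le_trans (ler_norm _) _; rewrite normrM normr_sign mul1r.
clear heta; lra.
Qed.

(** Fiber by fiber over the inputs outside [Y]: with [t] moving blocks [mixed_fiber] applies,
    otherwise the whole fiber is accepted. *)
Lemma card_btest_blocks (eta : R) : 0 <= eta ->
  (1 - (2 * p%:R ^+ 2)^-1) ^+ t * p%:R <= eta ^+ 2 ->
  (2 ^ #|I|)%N%:R * (1 / 2 - (p%:R^-1 + eta) / 2) <=
  #|[set u | (F u, b u) \in btest]|%:R :> R.
Proof.
move=> eta0 heta; have M0 : 0 < (2 ^ #|I|)%N%:R :> R by rewrite ltr0n expn_gt0.
rewrite -(ler_pM2l M0) -sum_bool_card -(sum_splice Y (fun u => ((F u, b u) \in btest)%:R)).
have -> : (2 ^ #|I|)%N%:R * ((2 ^ #|I|)%N%:R * (1 / 2 - (p%:R^-1 + eta) / 2)) =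
  \sum_(u : cube) ((2 ^ #|I|)%N%:R * (1 / 2 - (p%:R^-1 + eta) / 2)) :> R.
  by rewrite sumr_const card_ffun card_bool [LHS]mulr_natl.
apply: ler_sum => u _.
have [tm|tm] := leqP t #|moving u|.
  apply: le_trans (mixed_fiber eta0 heta tm) _; apply: ler_sum => y _.
  by rewrite ler_nat inE /=; case: (_ != _); rewrite ?orbT.
have -> : \sum_(y : cube) ((F (splice Y u y), b (splice Y u y)) \in btest)%:R =
    \sum_(y : cube) 1 :> R.
  apply: eq_bigr => y _; rewrite inE /=.
  have a : forall i, i \notin Y -> splice Y u y i = u i by move=> i; apply: splice_agree.
  (* With fewer than [t] moving blocks, either [t] blocks are fixed and the labels are unreactive,
     or fewer than [2 * t] blocks can show the pattern. *)
  have [tf|tf] := leqP t #|fixed u|.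
    by rewrite imset_f // inE (fixed_agree a).
  have -> : (patcount (false, true) Y blk (F (splice Y u y)) <= 2 * t)%N; last by rewrite orbT.
  apply: leq_trans (subset_leq_card (pat_fixed_moving _)) _.
  rewrite (fixed_agree a) (moving_agree a).
  apply: leq_trans (leq_card_setU _ _) _; lia.
rewrite sumr_const card_ffun card_bool -[leRHS]mulr1 ler_pM2l //.
have : 0 <= p%:R^-1 :> R by rewrite invr_ge0 ler0n.
clear heta; lra.
Qed.

Lemma block_bound (eta : R) : 0 <= eta ->
  (1 - (2 * p%:R ^+ 2)^-1) ^+ t * p%:R <= eta ^+ 2 ->
  1 / 2 - (p%:R^-1 + eta) / 2 -
    ((2 ^ #|I|)%N%:R / ((2 ^ t)%N%:R * (4 ^ #|V|)%N%:R) + t%:R^-1) <=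
  pr_push R (fun u => (F u, b u)) btest - pr_push R (fun L => (L, lfun p L)) btest.
Proof.
move=> eta0 heta; have c4 : #|{: bool * bool}| = 4%N by rewrite card_prod card_bool.
rewrite /pr_push !card_ffun card_bool c4 lerB //.
  by rewrite ler_pdivlMr ?ltr0n ?expn_gt0 // mulrC card_btest_blocks.
rewrite ler_pdivrMr ?ltr0n ?expn_gt0 // mulrDl; apply: le_trans card_btest_graph _.
rewrite [_^-1 * _]mulrC lerD2r.
by rewrite invfM mulrA divfK // pnatr_eq0 expn_eq0.
Qed.

End Blocks.

(** * The binary tree *)

Section Tree.
Local Open Scope nat_scope.

Lemma par_lt i : 0 < i -> par i < i.
Proof. rewrite /par; lia. Qed.

Lemma iter_par_le k i : iter k par i <= i.
Proof. by elim: k => //= k IH; apply: leq_trans IH; rewrite /par; lia. Qed.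

Lemma on_path0 j : on_path j 0 = false.
Proof.
apply/negP => /andP[j1 /existsP[k /eqP E]].
by have := iter_par_le k 0; rewrite E; lia.
Qed.

Lemma on_pathP j i : reflect (1 <= j /\ exists k, iter k par i = j) (on_path j i).
Proof.
apply: (iffP andP) => -[j1]; first by move=> /existsP[k /eqP E]; split=> //; exists k.
case=> k E; split=> //.
(* Above the root each step of [par] decreases the index, so the bound on [k] in [on_path] loses
   nothing. *)
have ki : k <= i - j.
  elim: k i E => // k IH i; rewrite iterSr => E.
  have := iter_par_le k (par i); rewrite E => ji.
  have i0 : 0 < i by move: ji; rewrite /par; lia.
  have := IH _ E; have := par_lt i0; lia.
have kl : k < i.+1 by lia.
by apply/existsP; exists (Ordinal kl); rewrite /= E.
Qed.

Lemma on_path_par j i : 0 < i ->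
  on_path j i = ((0 < j) && (j == i)) || on_path j (par i).
Proof.
move=> i0; apply/on_pathP/orP.
- case=> j0 [[|k]]; first by move=> /= ->; left; rewrite j0 eqxx.
  by rewrite iterSr => E; right; apply/on_pathP; split=> //; exists k.
- case=> [/andP[j0 /eqP ->]|/on_pathP[j0 [k E]]]; first by split=> //; exists 0.
  by split=> //; exists k.+1; rewrite iterSr.
Qed.

Lemma on_path_parF i : 0 < i -> on_path i (par i) = false.
Proof.
move=> i0; apply/negP => /on_pathP[_ [k E]].
by have := iter_par_le k (par i); have := par_lt i0; rewrite E; lia.
Qed.

Lemma hbit0 n d : hbit n d 0 = false.
Proof. by rewrite /hbit big1 // => j; rewrite on_path0. Qed.

Lemma hbit_par n d i : 0 < i < n -> hbit n d i = d i (+) hbit n d (par i).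
Proof.
move=> /andP[i0 ni]; rewrite /hbit big_mkcond [in RHS]big_mkcond /=.
have ii : i \in index_iota 1 n by rewrite mem_index_iota i0.
rewrite (bigD1_seq i) ?iota_uniq //= [in RHS](bigD1_seq i) ?iota_uniq //=.
rewrite on_path_parF // addFb on_path_par // i0 eqxx /=; congr (_ (+) _).
by apply: eq_bigr => j /negbTE ji; rewrite on_path_par // ji andbF.
Qed.

Lemma hbit_ext n d d' i : (forall j, 0 < j < n -> d j = d' j) ->
  hbit n d i = hbit n d' i.
Proof.
move=> dd'; rewrite /hbit big_nat_cond [in RHS]big_nat_cond.
by apply: eq_bigr => j /andP[jn _]; exact: dd'.
Qed.

Lemma zbitE m (z : {ffun 'I_m -> bool}) k (km : k < m) : zbit z k = z (Ordinal km).
Proof. by rewrite /zbit insubT. Qed.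

(* The index [v] stands for the vertex numbered [v.+1]. *)
Definition labels n m (o : {ffun 'I_m -> bool}) : {ffun 'I_n.-1 -> bool * bool} :=
  [ffun v : 'I_n.-1 => (hbit n (fun i => zbit o i.-1) v.+1, zbit o (n.-1 + v))].

Lemma zbit_pm_ext n p z k : k < 2 * n - 2 -> zbit (pm_ext n p z) k = zbit z k.
Proof.
move=> kN; have kN' : k < (2 * n - 2).+1 by lia.
by rewrite (zbitE _ kN') ffunE /= kN.
Qed.

Lemma labels_pm_ext n p z : labels n (pm_ext n p z) = labels n z.
Proof.
apply/ffunP => v; have := ltn_ord v; rewrite !ffunE => vn; congr pair.
  by apply: hbit_ext => j jn; apply: zbit_pm_ext; lia.
by apply: zbit_pm_ext; lia.
Qed.

Lemma pmmajmod_labels n p z : zbit (pm_ext n p z) (2 * n - 2) = lfun p (labels n z).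
Proof.
rewrite (zbitE _ (ltnSn _)) ffunE /= ltnn /pmmajmod /lfun /lsum; congr (MM p _ (+) _).
  rewrite big_add1 big_mkord; apply: eq_bigr => v _; by rewrite ffunE /lval /=.
by rewrite big_add1 big_mkord; apply: eq_bigr => v _; rewrite ffunE.
Qed.

Lemma labels_inj n : injective (@labels n (2 * n - 2)).
Proof.
move=> z z' E.
have hE i : i < n -> hbit n (fun i => zbit z i.-1) i = hbit n (fun i => zbit z' i.-1) i.
  case: i => [|i] ni; first by rewrite !hbit0.
  have ni' : i < n.-1 by lia.
  by have := congr1 (fun L : {ffun _} => (L (Ordinal ni')).1) E; rewrite !ffunE.
(* The bit [d i] is the difference of [h] at [i] and at its parent. *)
have dE i : 0 < i < n -> zbit z i.-1 = zbit z' i.-1.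
  move=> i0; have /andP[i1 ni] := i0.
  have pn : par i < n by have := par_lt i1; lia.
  have := hE i ni; rewrite hbit_par // [in RHS]hbit_par // (hE _ pn).
  exact: addIb.
apply/ffunP => k; have kN := ltn_ord k.
have eqz (w : {ffun 'I_(2 * n - 2) -> bool}) : w k = zbit w k.
  by rewrite (zbitE w kN); congr (w _); apply: val_inj.
rewrite !eqz; have [kn|nk] := ltnP k n.-1.
  by apply: (dE k.+1); lia.
have kn' : k - n.-1 < n.-1 by lia.
have := congr1 (fun L : {ffun _} => (L (Ordinal kn')).2) E.
by rewrite !ffunE /= subnKC.
Qed.

End Tree.

(** * Subtrees below a cutoff *)

Section Units.
Local Open Scope nat_scope.
Variable a : nat.

(* [(rt i).-1] is the highest ancestor of the vertex [i] numbered at least [a]: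
   in the numbering from 1, taking the parent is halving. *)
Definition rt (i : nat) : nat := i.+1 %/ 2 ^ trunc_log 2 (i.+1 %/ a.+1).

(** Passing to the parent halves [i.+1] and lowers the truncated logarithm by one, so the quotient
    is unchanged. *)
Lemma rt_par i : a <= par i -> rt i = rt (par i).
Proof.
move=> api; case: i api => [|i] api.
  by congr rt; rewrite /par.
have E : (par i.+1).+1 = i.+2 %/ 2 by rewrite /par /=; lia.
have E2 : i.+2 %/ 2 %/ a.+1 = (i.+2 %/ a.+1)./2 by rewrite divnAC divn2.
have q2 : 1 < i.+2 %/ a.+1.
  by rewrite leq_divRL //; move: api; rewrite /par /=; lia.
by rewrite /rt E E2 (trunc_log2S q2) expnS divnMA.
Qed.

(* The vertices at depth [k] below the vertex [r.-1] are numbered from 1 as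
   [r.-1 * 2 ^ k + m] with [2 ^ k <= m < 2 ^ k.+1], so [m] identifies them. *)
Lemma card_unit n r :
  #|[set v : 'I_n.-1 | (a <= v.+1) && (rt v.+1 == r)]| <= 2 * (n %/ a.+1).
Proof.
set q := n %/ a.+1.
(* [g] inverts [h]; the index [v] stands for the vertex numbered [v.+2] from 1, hence [.-2]. *)
pose g (m : nat) := (r.-1 * 2 ^ trunc_log 2 m + m).-2.
rewrite -[leqRHS]card_ord.
pose h (v : 'I_n.-1) : nat := v.+2 - r.-1 * 2 ^ trunc_log 2 (v.+2 %/ a.+1).
have key (v : 'I_n.-1) : a <= v.+1 -> rt v.+1 = r -> h v < 2 * q /\ g (h v) = v.
  move=> av; rewrite /rt => rE; set k := trunc_log 2 (v.+2 %/ a.+1) in rE *.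
  have vn := ltn_ord v.
  have q0 : 0 < v.+2 %/ a.+1 by rewrite divn_gt0 //; lia.
  have kq : 2 ^ k <= v.+2 %/ a.+1 by apply: trunc_logP.
  have vq : v.+2 %/ a.+1 <= q by apply: leq_div2r; lia.
  have k0 : 0 < 2 ^ k by rewrite expn_gt0.
  have r0 : 0 < r.
    rewrite -rE divn_gt0 //; apply: leq_trans kq _; exact: leq_div.
  have D := divn_eq v.+2 (2 ^ k); rewrite rE in D.
  have M := ltn_pmod v.+2 k0.
  have hE : h v = 2 ^ k + v.+2 %% 2 ^ k.
    rewrite /h -/k {1}D; case: (r) r0 => // r' _; rewrite mulSn /=; lia.
  have tk : trunc_log 2 (h v) = k.
    apply: trunc_log_eq => //; rewrite hE expnS; lia.
  split; first by rewrite hE; lia.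
  rewrite /g tk hE.
  have -> : r.-1 * 2 ^ k + (2 ^ k + v.+2 %% 2 ^ k) = v.+2.
    by rewrite {2}D; case: (r) r0 => // r' _; rewrite mulSn /=; lia.
  by [].
have [q0|q0] := posnP q.
  rewrite [X in X <= _](_ : _ = 0) //; apply: eq_card0 => v; rewrite inE; apply/negP.
  move=> /andP[av /eqP rE]; by have [] := key v av rE; rewrite q0.
have qq : (2 * q).-1.+1 = 2 * q by lia.
rewrite -qq -(card_in_imset (f := fun v => inord (h v) : 'I_(2 * q).-1.+1)).
  exact: max_card.
move=> v w; rewrite !inE => /andP[av /eqP rv] /andP[aw /eqP rw].
move=> /(congr1 val) /=; have [hv gv] := key v av rv; have [hw gw] := key w aw rw.
rewrite !inordK ?qq // => hE.
by apply: val_inj => /=; rewrite -gv -gw hE.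
Qed.

End Units.

Lemma card_bigcup_le (T U : finType) (A : {set T}) (B : T -> {set U}) (m : nat) :
  (forall i, i \in A -> #|B i| <= m)%N -> (#|\bigcup_(i in A) B i| <= #|A| * m)%N.
Proof.
move=> h; rewrite -sum_nat_const.
apply: leq_trans (_ : \sum_(i in A) #|B i| <= _)%N; last exact: leq_sum.
elim/big_ind2: _ => [|x1 x2 y1 y2 h1 h2|//]; first by rewrite cards0.
by apply: leq_trans (leq_card_setU _ _) _; apply: leq_add.
Qed.

(** * Inputs controlling separate blocks of the tree *)

Section TreeBlocks.
Local Open Scope nat_scope.
Variables (n l D : nat) (f : {ffun 'I_l -> bool} -> {ffun 'I_((2 * n - 2).+1) -> bool}).
Variable S : 'I_((2 * n - 2).+1) -> {set 'I_l}.
Hypothesis S_le : forall j, #|S j| <= D.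
Hypothesis S_loc : forall j (u v : {ffun 'I_l -> bool}),
  (forall i, i \in S j -> u i = v i) -> f u j = f v j.
Hypotheses (D0 : 0 < D) (nD : 32 * D <= n) (nl : n.-1 <= l).

Local Notation vtx := 'I_n.-1.
Let a := n %/ (16 * D).

Definition bdep (k : nat) : {set 'I_l} :=
  if @insub nat (fun i => i < (2 * n - 2).+1) 'I_((2 * n - 2).+1) k is Some j then S j
  else set0.

Lemma bdep_le k : #|bdep k| <= D.
Proof. by rewrite /bdep; case: insubP => [j _ _|_]; rewrite ?S_le ?cards0. Qed.

Lemma zbit_loc k (u v : {ffun 'I_l -> bool}) : (forall i, i \in bdep k -> u i = v i) ->
  zbit (f u) k = zbit (f v) k.
Proof. by rewrite /zbit /bdep; case: insubP => // j _ _; apply: S_loc. Qed.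

(** Only the two output bits at the vertex itself are counted; its label also involves the [d] bits
    of its ancestors. *)
Definition Dep (v : vtx) : {set 'I_l} := bdep v :|: bdep (n.-1 + v).

Lemma Dep_le v : #|Dep v| <= 2 * D.
Proof.
apply: leq_trans (leq_card_setU _ _) _.
by have := bdep_le v; have := bdep_le (n.-1 + v); lia.
Qed.

(** The inputs of the last output bit are included so that this bit is constant once the inputs
    outside [Y] are fixed. *)
Definition top_dep : {set 'I_l} :=
  (\bigcup_(v in [set v : vtx | v.+1 < a]) Dep v) :|: bdep (2 * n - 2).

Definition subtree (r : nat) : {set vtx} :=
  [set v : vtx | (a <= v.+1) && (rt a v.+1 == r)].

Definition adj (e : 'I_l) : {set vtx} := [set v | e \in Dep v].

Definition low : {set 'I_l} := [set e | (e \notin top_dep) && (#|adj e| <= 8 * D)].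

Definition nbr (e : 'I_l) : {set vtx} := \bigcup_(v in adj e) subtree (rt a v.+1).

(** The inputs sharing a subtree with [e]. *)
Definition conf (e : 'I_l) : {set 'I_l} := \bigcup_(v in nbr e) Dep v.

Lemma a_gt0 : 0 < a.
Proof. by rewrite /a divn_gt0; lia. Qed.

Lemma subtree_le r : #|subtree r| <= 32 * D.
Proof.
apply: leq_trans (card_unit _ _ _) _.
have : n %/ a.+1 <= 16 * D.
  by rewrite -ltnS ltn_divLR // /a; have := ltn_ceil n (_ : 0 < 16 * D); lia.
lia.
Qed.

Lemma nbr_le e : e \in low -> #|nbr e| <= 256 * D ^ 2.
Proof.
rewrite inE => /andP[_ he].
apply: leq_trans (card_bigcup_le (fun v _ => subtree_le _)) _.
by rewrite -[256]/(8 * 32) expnS expn1 mulnACA leq_mul2r he orbT.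
Qed.

Lemma conf_le e : e \in low -> #|conf e| <= 512 * D ^ 3.
Proof.
move=> /nbr_le he; apply: leq_trans (card_bigcup_le (fun v _ => Dep_le v)) _.
by rewrite -[512]/(256 * 2) (expnSr D 2) mulnACA leq_mul2r he orbT.
Qed.

Lemma adj_bot e v : e \notin top_dep -> v \in adj e -> a <= v.+1.
Proof.
move=> et; rewrite inE => ev; rewrite leqNgt; apply: contra et => va.
by rewrite inE; apply/orP; left; apply/bigcupP; exists v => //; rewrite inE.
Qed.

(** A vertex reading [e] lies in its own [subtree] only if it is below the cutoff, which
    [e \notin top_dep] ensures. *)
Lemma conf_sym e e' : e \notin top_dep -> e' \in conf e -> e \in conf e'.
Proof.
move=> et /bigcupP[v' /bigcupP[v va]]; rewrite inE => /andP[av' /eqP rE] ve'.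
have va' := va; rewrite inE in va.
apply/bigcupP; exists v => //; apply/bigcupP; exists v'; first by rewrite inE.
by rewrite inE rE eqxx (adj_bot et va').
Qed.

(** Of at least [n - 1] inputs, about [n / 8 + D] at most are read by the top or the last bit, and
    at most a quarter of [n - 1] have degree above [8 * D], the degrees adding up to at most
    [2 * D * (n - 1)]. *)
Lemma low_large : n <= 2 * #|low|.
Proof.
pose high := [set e : 'I_l | 8 * D < #|adj e|].
have h1 : l <= #|low| + (#|top_dep| + #|high|).
  rewrite -{1}(card_ord l) -cardsT.
  apply: leq_trans (_ : #|low :|: (top_dep :|: high)| <= _).
    apply: subset_leq_card; apply/subsetP => e _; rewrite !inE /=.
    rewrite leqNgt; case: (e \in _) => //=; case: (e \in _) => //=; by case: (_ < _).
  apply: leq_trans (leq_card_setU _ _) _; rewrite leq_add2l; exact: leq_card_setU.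
have h2 : #|top_dep| <= a * (2 * D) + D.
  apply: leq_trans (leq_card_setU _ _) _; apply: leq_add; last exact: bdep_le.
  apply: leq_trans (card_bigcup_le (fun v _ => Dep_le v)) _.
  rewrite leq_mul2r; apply/orP; right.
  rewrite -[leqRHS](card_ord a).
  rewrite -(card_in_imset (f := fun v : vtx => inord v : 'I_a.-1.+1)).
    apply: leq_trans (max_card _) _; rewrite !card_ord; have := a_gt0; lia.
  move=> v w; rewrite !inE => va wa /(congr1 val) /=.
  rewrite !inordK; [|lia|lia]; exact: val_inj.
have h3 : #|high| * (8 * D) <= n.-1 * (2 * D).
  apply: leq_trans (_ : \sum_(e : 'I_l) #|adj e| <= _).
    rewrite -sum_nat_const; apply: leq_trans (_ : \sum_(e in high) #|adj e| <= _).
      by apply: leq_sum => e; rewrite inE => /ltnW.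
    by rewrite [leqRHS](bigID (mem high)) /= leq_addr.
  have -> : \sum_(e : 'I_l) #|adj e| = \sum_(v : vtx) #|Dep v|.
    have c1 (e : 'I_l) : #|adj e| = \sum_(v : vtx) (e \in Dep v).
      by rewrite -sum1dep_card big_mkcond /=; apply: eq_bigr => v _; case: (_ \in _).
    have c2 (v : vtx) : #|Dep v| = \sum_(e : 'I_l) (e \in Dep v).
      by rewrite -sum1_card big_mkcond /=; apply: eq_bigr => e _; case: (_ \in _).
    by rewrite (eq_bigr _ (fun e _ => c1 e)) (eq_bigr _ (fun v _ => c2 v)) exchange_big.
  apply: leq_trans (_ : \sum_(v : vtx) 2 * D <= _); first by
    apply: leq_sum => v _; apply: Dep_le.
  by rewrite sum_nat_const card_ord.
have h4 : 4 * #|high| <= n.-1.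
  rewrite -(leq_pmul2r (_ : 0 < 2 * D)); lia.
have h5 : a * (16 * D) <= n by apply: leq_divM.
lia.
Qed.

Definition nonconf (Y : {set 'I_l}) : bool :=
  (Y \subset low) &&
  [forall (e | e \in Y), forall (e' | e' \in Y), (e' \in conf e) ==> (e' == e)].

(** [Y] is a maximal conflict-free subset of [low], and [own v] is the only member of [Y] read in
    the subtree of [v]. By maximality [low] is covered by [Y] and its conflicts, which bounds [#|Y|]
    from below. *)
Lemma tree_blocks : exists (Y : {set 'I_l}) (own : vtx -> option 'I_l),
  [/\ forall v (u u' : {ffun 'I_l -> bool}),
        (forall i, i \notin Y \/ own v = Some i -> u i = u' i) ->
        labels n (f u) v = labels n (f u') v,
      forall u u' : {ffun 'I_l -> bool}, (forall i, i \notin Y -> u i = u' i) ->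
        zbit (f u) (2 * n - 2) = zbit (f u') (2 * n - 2),
      forall j, j \in Y -> #|blk own j| <= 256 * D ^ 2 &
      n <= 2 * (#|Y| * (1 + 512 * D ^ 3))].
Proof.
have nc0 : nonconf set0.
  by rewrite /nonconf sub0set; apply/forall_inP => e; rewrite inE.
have [Y /maxsetP[/andP[Ylow /forall_inP Yc] Ymax] _] := maxset_exists nc0.
have {}Yc e e' : e \in Y -> e' \in Y -> e' \in conf e -> e' = e.
  by move=> eY e'Y /(implyP (forall_inP (Yc e eY) e' e'Y)) /eqP.
have Ytop e : e \in Y -> e \notin top_dep.
  by move=> /(subsetP Ylow); rewrite inE => /andP[].
pose udep r := \bigcup_(v in subtree r) Dep v.
pose own (v : vtx) := if v.+1 < a then None else [pick j in Y | j \in udep (rt a v.+1)].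
have udep_uniq r j j' : j \in Y -> j' \in Y -> j \in udep r -> j' \in udep r -> j' = j.
  move=> jY j'Y /bigcupP[v vr jv] /bigcupP[v' v'r j'v']; apply: Yc => //.
  apply/bigcupP; exists v' => //; apply/bigcupP; exists v; first by rewrite inE.
  by move: vr v'r; rewrite !inE => /andP[_ /eqP ->].
have ownE (v : vtx) i : a <= v.+1 -> i \in Y -> i \in udep (rt a v.+1) -> own v = Some i.
  move=> av iY iu; rewrite /own ltnNge av /=; case: pickP => [j /andP[jY ju]|/(_ i)].
    by rewrite (udep_uniq _ i j iY jY iu ju).
  by rewrite iY iu.
exists Y, own; split.
- move=> v u u' uu'.
  have out i : i \notin Y -> u i = u' i by move=> iY; apply: uu'; left.
  have Dtop (w : vtx) i : w.+1 < a -> i \in Dep w -> u i = u' i.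
    move=> wa iw; apply: out; apply/negP => /Ytop; rewrite inE negb_or => /andP[/negP[]].
    by apply/bigcupP; exists w => //; rewrite inE.
  (* Induction towards the root: the parent of [k] lies in the same subtree or in the top, so no
     other subtree is read. *)
  have hloc k : (forall w : vtx, w.+1 <= k -> (w.+1 < a) || (rt a w.+1 == rt a k) ->
        forall i, i \in Dep w -> u i = u' i) -> k < n ->
      hbit n (fun i => zbit (f u) i.-1) k = hbit n (fun i => zbit (f u') i.-1) k.
    elim/ltn_ind: k => k IH hk kn.
    have [k0|k0] := posnP k; first by rewrite k0 !hbit0.
    rewrite hbit_par ?k0 // [in RHS]hbit_par ?k0 //; congr (_ (+) _).
      have kn' : k.-1 < n.-1 by lia.
      apply: zbit_loc => i ik; apply: (hk (Ordinal kn')) => /=; rewrite ?prednK ?eqxx ?orbT //.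
      by rewrite inE ik.
    have pk := par_lt k0; apply: IH => //; last by lia.
    move=> w wk hw; apply: hk; first by lia.
    have [pa|pa] := ltnP (par k) a; last by rewrite (rt_par pa).
    by apply/orP; left; case/orP: hw => // _; lia.
  have hv (w : vtx) : w <= v -> (w.+1 < a) || (rt a w.+1 == rt a v.+1) ->
      forall i, i \in Dep w -> u i = u' i.
    move=> wv; have [wa _ i|aw /= /eqP rE i iw] := ltnP w.+1 a; first exact: Dtop.
    have [iY|iY] := boolP (i \in Y); last exact: out.
    have iu : i \in udep (rt a v.+1).
      by apply/bigcupP; exists w => //; rewrite inE aw rE eqxx.
    by apply: uu'; right; apply: ownE => //; lia.
  rewrite !ffunE; congr pair.
    by apply: hloc => [w wv|]; [exact: hv | have := ltn_ord v; lia].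
  apply: zbit_loc => i iv; apply: (hv v) => //; first by rewrite eqxx orbT.
  by rewrite inE iv orbT.
- move=> u u' uu'; apply: zbit_loc => i iN; apply: uu'; apply/negP => /Ytop.
  by rewrite inE iN orbT.
- move=> j jY; apply: leq_trans (nbr_le (subsetP Ylow j jY)).
  apply: subset_leq_card; apply/subsetP => v; rewrite inE /own.
  case: ltnP => // av /eqP; case: pickP => // j' /andP[_ ju] [jj]; rewrite jj in ju.
  case/bigcupP: ju => w; rewrite inE => /andP[aw /eqP rE] jw.
  by apply/bigcupP; exists w; rewrite inE // av rE eqxx.
have lowY : low \subset Y :|: \bigcup_(e in Y) conf e.
  apply/subsetP => e el; rewrite inE; have [//|eY] := boolP (e \in Y).
  have et : e \notin top_dep by move: el; rewrite inE => /andP[].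
  apply/negPn/negP => ne.
  have {}ne e' : e' \in Y -> e \notin conf e'.
    by move=> e'Y; apply: contra ne => ec; apply/bigcupP; exists e'.
  (* An uncovered [e] could be added to [Y]; [conf_sym] excludes conflicts in the other
     direction. *)
  have : nonconf (e |: Y).
    rewrite /nonconf subUset sub1set el Ylow /=.
    apply/forall_inP => x xY; apply/forall_inP => y yY; apply/implyP => yx.
    move: xY yY; rewrite !inE => /orP[/eqP xe|xY] /orP[/eqP ye|yY].
    - by rewrite xe ye.
    - by have := ne y yY; rewrite -xe conf_sym // xe.
    - by have := ne x xY; rewrite -ye yx.
    - by rewrite (Yc x y).
  move=> /Ymax /(_ (subsetUr _ _)) E; by rewrite -E !inE eqxx in eY.
have := low_large; have := subset_leq_card lowY.
have : #|Y :|: \bigcup_(e in Y) conf e| <= #|Y| + #|\bigcup_(e in Y) conf e|.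
  exact: leq_card_setU.
have := card_bigcup_le (fun e eY => conf_le (subsetP Ylow e eY)).
rewrite mulnDr muln1; set X := _ * (512 * _); lia.
Qed.

End TreeBlocks.

(** * Total variation distance *)

Section TotalVariation.
Variables (R : realType).

Lemma le_tvd (A1 A2 B : finType) (g1 : A1 -> B) (g2 : A2 -> B) T :
  pr_push R g1 T - pr_push R g2 T <= tvd R g1 g2.
Proof.
apply: le_trans (ler_norm _) _.
exact: (le_bigmax 0 (fun T => `|pr_push R g1 T - pr_push R g2 T|)).
Qed.

Lemma pr_push_comp (A B C : finType) (g : A -> B) (h : B -> C) (T : {set C}) :
  pr_push R g (h @^-1: T) = pr_push R (h \o g) T.
Proof. by rewrite /pr_push; congr (_%:R / _); apply: eq_card => x; rewrite !inE. Qed.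

Lemma pr_push_bij (A B C : finType) (g : A -> B) (h : B -> C) (T : {set C}) : bijective g ->
  pr_push R (h \o g) T = pr_push R h T.
Proof.
move=> bg; rewrite /pr_push (bij_eq_card bg); congr (_%:R / _).
rewrite -[RHS](on_card_preimset (f := g)); last exact: onW_bij.
by apply: eq_card => x; rewrite !inE.
Qed.

Lemma labels_bij n : bijective (@labels n (2 * n - 2)).
Proof.
apply: inj_card_bij (@labels_inj n) _.
rewrite !card_ffun card_prod card_bool !card_ord -[(2 * 2)%N]/(2 ^ 2)%N -expnM.
by rewrite leq_exp2l //; lia.
Qed.

(** With so few inputs, the image of [f] contains at most half of the equally likely target
    points. *)
Lemma tvd_image n p l (f : {ffun 'I_l -> bool} -> {ffun 'I_((2 * n - 2).+1) -> bool}) :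
  (l < n.-1)%N -> 1 / 2 <= tvd R f (pm_ext n p).
Proof.
move=> ln; pose T := f @: setT.
apply: le_trans (le_tvd f (pm_ext n p) T).
have -> : pr_push R f T = 1.
  rewrite /pr_push (_ : [set a | f a \in T] = setT) ?cardsT.
    by rewrite divff // pnatr_eq0 card_ffun card_bool expn_eq0.
  by apply/setP => u; rewrite !inE imset_f.
suff : pr_push R (pm_ext n p) T <= 1 / 2 by lra.
rewrite /pr_push card_ffun card_bool card_ord.
rewrite ler_pdivrMr ?ltr0n ?expn_gt0 // mul1r mulrC ler_pdivlMr ?ltr0n // -natrM ler_nat.
have gi : injective (pm_ext n p).
  by move=> z z' /(congr1 (@labels n _)); rewrite !labels_pm_ext => /labels_inj.
apply: leq_trans (_ : 2 ^ l * 2 <= _)%N; last by rewrite -expnSr leq_exp2l //; lia.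
rewrite leq_mul2r /=.
apply: leq_trans (_ : #|T| <= _)%N; last first.
  by apply: leq_trans (leq_imset_card _ _) _; rewrite cardsT card_ffun card_bool card_ord.
rewrite -(card_imset _ gi); apply: subset_leq_card; apply/subsetP => o /imsetP[z].
by rewrite inE => h ->.
Qed.

Lemma tvd_blocks n p l D t eta
    (f : {ffun 'I_l -> bool} -> {ffun 'I_((2 * n - 2).+1) -> bool})
    (S : 'I_((2 * n - 2).+1) -> {set 'I_l}) :
  (forall j, #|S j| <= D)%N ->
  (forall j (u v : {ffun 'I_l -> bool}),
    (forall i, i \in S j -> u i = v i) -> f u j = f v j) ->
  (0 < D)%N -> (n.-1 <= l)%N -> prime p -> (512 * D ^ 2 < p)%N -> (0 < t)%N ->
  (8 * t * (4 ^ (256 * D ^ 2) * (1 + 512 * D ^ 3)) <= n)%N ->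
  0 <= eta -> (1 - (2 * p%:R ^+ 2)^-1) ^+ t * p%:R <= eta ^+ 2 ->
  1 / 2 - (p%:R^-1 + eta) / 2 -
    ((2 ^ l)%N%:R / ((2 ^ t)%N%:R * (2 ^ (2 * n - 2))%N%:R) + t%:R^-1) <=
  tvd R f (pm_ext n p).
Proof.
move=> S_le S_loc D0 nl p_pr pD t0 hn eta0 heta.
have p_odd : odd p by case: (even_prime p_pr) => // p2; move: pD; rewrite p2; nia.
set M := (1 + 512 * D ^ 3)%N in hn; have M0 : (0 < M)%N by [].
have K0 : (0 < 4 ^ (256 * D ^ 2))%N by rewrite expn_gt0.
have nD : (32 * D <= n)%N.
  apply: leq_trans hn; rewrite -mulnA -[32%N]/(8 * 4)%N -mulnA leq_mul2l /=.
  have : (4 * D <= M)%N by rewrite /M; nia.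
  move=> h; apply: leq_trans h _; rewrite mulnA leq_pmull // muln_gt0 t0; exact: K0.
have [Y [own [locF locb hK hY]]] := tree_blocks S_le S_loc D0 nD nl.
set K := (256 * D ^ 2)%N in hK hn K0 *.
have hY' : (4 * t * 4 ^ K <= #|Y|)%N.
  rewrite -(leq_pmul2r M0) -(leq_pmul2l (_ : 0 < 2)%N) //.
  apply: leq_trans hY; apply: leq_trans hn; apply: eq_leq; rewrite -!mulnA; lia.
have pK : (2 * K < p)%N by rewrite /K mulnA.
have := block_bound p_pr p_odd locF locb hK pK t0 hY' eta0 heta.
rewrite !card_ord.
have -> : (4 ^ n.-1 = 2 ^ (2 * n - 2))%N.
  by rewrite -[4%N]/(2 ^ 2)%N -expnM; congr (_ ^ _)%N; lia.
move/le_trans; apply.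
set T := btest _ _ _ _ _.
(* The test on labels is pulled back along [dec]; [labels_bij] makes the labels of the target
   uniform. *)
pose dec (o : {ffun 'I_((2 * n - 2).+1) -> bool}) := (labels n o, zbit o (2 * n - 2)).
have := le_tvd f (pm_ext n p) (dec @^-1: T); rewrite !pr_push_comp.
apply: le_trans; rewrite lerD2l lerN2.
rewrite -(pr_push_bij (fun L => (L, lfun p L)) T (labels_bij n)).
rewrite le_eqVlt; apply/orP; left; apply/eqP.
rewrite /pr_push; congr (_%:R / _); apply: eq_card => z.
by rewrite !inE /= /dec labels_pm_ext pmmajmod_labels.
Qed.

End TotalVariation.

(** * Choice of parameters *)

Section Asymptotics.
Variable R : realType.

Lemma powR_eventually (g A : R) : 0 < g ->
  exists n0, forall n, (n0 <= n)%N -> A <= (2 * n - 2)%N%:R `^ g.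
Proof.
move=> g0; pose M := Num.max 1 A `^ g^-1; exists (Num.truncn M).+3 => n hn.
have m0 : 0 <= Num.max 1 A by rewrite le_max ler01.
have M0 : 0 <= M by apply: powR_ge0.
have MN : M <= (2 * n - 2)%N%:R.
  apply/ltW; rewrite -truncn_lt_nat //; lia.
apply: le_trans (_ : M `^ g <= _); last first.
  by apply: ge0_ler_powR => //; [exact: ltW | rewrite nnegrE ler0n].
by rewrite -powRrM mulVf ?gt_eqF // powRr1 // le_max lexx orbT.
Qed.

Lemma ln_le_powR (x g : R) : 0 < x -> g * ln x <= x `^ g.
Proof. by move=> x0; rewrite -ln_powR; apply/ltW/ln_sublinear/powR_gt0. Qed.

(** The exponents are [512 * D ^ 2] for the power of 4, 3 for the 8, and [10 + 3 * D] for the last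
    factor, and [528 = 512 + 3 + 10 + 3]. *)
Lemma block_size_bound D : (0 < D)%N ->
  (8 * (4 ^ (256 * D ^ 2) * (1 + 512 * D ^ 3)) <= 2 ^ (528 * D ^ 2))%N.
Proof.
move=> D0; have D2 : (0 < D ^ 2)%N by rewrite expn_gt0 D0.
have -> : (4 ^ (256 * D ^ 2) = 2 ^ (512 * D ^ 2))%N.
  by rewrite -[4%N]/(2 ^ 2)%N -expnM mulnA.
have -> : (528 * D ^ 2 = 3 * D ^ 2 + (512 * D ^ 2 + (10 * D ^ 2 + 3 * D ^ 2)))%N by lia.
rewrite [leqRHS]expnD [X in (_ <= _ * X)%N]expnD [X in (_ <= _ * (_ * X))%N]expnD.
apply: leq_mul.
  by rewrite -[8%N]/(2 ^ 3)%N leq_exp2l //; lia.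
rewrite leq_mul2l; apply/orP; right.
apply: leq_trans (_ : 2 ^ 10 * D ^ 3 <= _)%N.
  have : (0 < D ^ 3)%N by rewrite expn_gt0 D0.
  rewrite -[(2 ^ 10)%N]/1024%N; lia.
apply: leq_mul; first by rewrite leq_exp2l //; lia.
apply: leq_trans (_ : (2 ^ D) ^ 3 <= _)%N; first by rewrite leq_exp2r // ltnW // ltn_expl.
rewrite -expnM leq_exp2l // mulnC leq_mul2l /= expnS expn1; nia.
Qed.

Lemma trunc_sqrt_sqr (y : R) : 0 <= y ->
  (Num.truncn (Num.sqrt y)).+1%:R ^+ 2 <= 2 * y + 2.
Proof.
move=> y0; set D := Num.truncn _.
have hD : D%:R <= Num.sqrt y by rewrite truncn_le sqrtr_ge0.
have : D%:R ^+ 2 <= y.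
  rewrite -[leRHS]sqr_sqrtr // lerXn2r ?nnegrE ?sqrtr_ge0 //.
rewrite -natr1; have : 0 <= (D%:R - 1) ^+ 2 :> R by apply: sqr_ge0.
nra.
Qed.

Lemma pow2_le_expR (k : nat) : (2 ^ k)%N%:R <= expR k%:R :> R.
Proof.
rewrite natrX -[X in expR X]mul1r expRM_natr lerXn2r ?nnegrE ?expR_ge0 //.
by apply: le_trans (expR_ge1Dx 1); lra.
Qed.

(** The power is at most [exp (- t / (2 * p ^ 2)) <= N ^ -3], and [p <= N]; thus [eta = 1 / N] is
    admissible in [tvd_blocks]. *)
Lemma geometric_decay (N p t : nat) (c2 alpha beta : R) :
  (2 <= N)%N -> (0 < p)%N -> p%:R <= c2 * N%:R `^ alpha -> p%:R <= N%:R :> R ->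
  2 * N%:R `^ beta <= t%:R ->
  3 * ln N%:R * (c2 * N%:R `^ alpha) ^+ 2 <= N%:R `^ beta ->
  (1 - (2 * p%:R ^+ 2)^-1) ^+ t * p%:R <= (N%:R^-1 : R) ^+ 2.
Proof.
move=> N2 p0 pc pN tN key.
have Nr : 0 < N%:R :> R by rewrite ltr0n; lia.
have pr : 0 < p%:R :> R by rewrite ltr0n.
have lN : 0 <= ln (N%:R : R) by apply: ln_ge0; rewrite ler1n; lia.
set y := (2 * p%:R ^+ 2)^-1.
have p2 : 0 < 2 * p%:R ^+ 2 :> R by rewrite mulr_gt0 // exprn_gt0.
have y1 : 0 <= 1 - y.
  rewrite subr_ge0 invf_le1 // -natrX -natrM ler1n muln_gt0 /= expn_gt0 p0.
  by [].
have h1 : (1 - y) ^+ t <= expR (- y * t%:R).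
  by rewrite expRM_natr lerXn2r ?nnegrE ?expR_ge0 //; apply: le_trans (expR_ge1Dx _).
have h2 : 3 * ln N%:R <= y * t%:R.
  rewrite [y * _]mulrC ler_pdivlMr //.
  have : p%:R ^+ 2 <= (c2 * N%:R `^ alpha) ^+ 2.
    by rewrite lerXn2r ?nnegrE // ltW // (lt_le_trans pr).
  move: key tN; set u := (_ * _) ^+ 2; set w := _ `^ beta; set L := ln _ in lN *; nra.
have h3 : expR (- y * t%:R) <= (N%:R ^+ 3)^-1.
  have -> : (N%:R ^+ 3)^-1 = expR (- (3 * ln N%:R)) :> R.
    by rewrite expRN expRM_natl lnK.
  by rewrite ler_expR mulNr lerN2.
apply: le_trans (_ : (N%:R ^+ 3)^-1 * N%:R <= _).
  apply: ler_pM => //; first by apply: exprn_ge0.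
  exact: le_trans h1 h3.
rewrite exprS invfM mulrAC mulVf ?gt_eqF // mul1r exprVn.
exact: lexx.
Qed.

(** The exponent [l - t - N] is at most [- t / 2], so the term is even exponentially small in
    [t]. *)
Lemma entropy_term (l N t : nat) : (0 < t)%N -> (2 * l <= 2 * N + t)%N ->
  (2 ^ l)%N%:R / ((2 ^ t)%N%:R * (2 ^ N)%N%:R) <= 2 / t%:R :> R.
Proof.
move=> t0 h.
rewrite -natrM -expnD ler_pdivrMr ?ltr0n ?expn_gt0 //.
rewrite mulrAC ler_pdivlMr ?ltr0n // -!natrM ler_nat.
have E : (l + uphalf t <= t + N)%N by lia.
apply: leq_trans (_ : 2 * 2 ^ (l + uphalf t) <= _)%N; last by rewrite leq_mul2l leq_exp2l.
rewrite expnD mulnCA leq_mul2l; apply/orP; right.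
have : (uphalf t <= 2 ^ uphalf t)%N by rewrite ltnW // ltn_expl.
lia.
Qed.

End Asymptotics.

Lemma powR_add (R : realType) (x r s : R) : 0 < x -> x `^ (r + s) = x `^ r * x `^ s.
Proof. by move=> x0; rewrite powRD // (gt_eqF x0) implybT. Qed.

Lemma block_count_eventually (R : realType) (beta : R) : 0 < beta < 1 ->
  exists2 eps : R, 0 < eps <= 1 & exists n0, forall n, (n0 <= n)%N ->
  forall D t : nat, (0 < D)%N -> t%:R <= 3 * (2 * n - 2)%N%:R `^ beta ->
  D%:R ^+ 2 <= 2 * (eps * ln (2 * n - 2)%N%:R) + 2 ->
  (8 * t * (4 ^ (256 * D ^ 2) * (1 + 512 * D ^ 3)) <= n)%N.
Proof.
(* [528 * D ^ 2 <= 1056 * eps * ln N + 1056] and [1056 * eps = (1 - beta) / 2], so the block factor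
   is at most [exp 1056 * N ^ ((1 - beta) / 2)]; another such power of [N] absorbs the constants. *)
move=> /andP[b0 b1]; exists ((1 - beta) / 2112); first by apply/andP; split; lra.
have g0 : 0 < (1 - beta) / 2 by lra.
have [n1 h1] := powR_eventually (6 * expR 1056) g0.
exists (n1 + 2)%N => n hn D t D0 tN DN.
have N0 : (0 < 2 * n - 2)%N by move: hn; clear; lia.
have {hn h1} key := h1 n (leq_trans (leq_addr _ _) hn).
have Nn : (2 * n - 2)%N%:R <= 2 * n%:R :> R by rewrite -natrM ler_nat leq_subr.
move: (2 * n - 2)%N => N in N0 key Nn tN DN *.
have Nr : 0 < N%:R :> R by rewrite ltr0n.
set E := expR 1056 in key *; set P := N%:R `^ _ in key *.
have E0 : 0 < E by apply: expR_gt0.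
have h1 : (2 ^ (528 * D ^ 2))%N%:R <= E * P.
  apply: le_trans (pow2_le_expR _ _) _.
  have -> : P = expR ((1 - beta) / 2 * ln N%:R) by rewrite /P /powR gt_eqF.
  rewrite /E -expRD ler_expR natrM natrX.
  move: DN; set d := D%:R ^+ 2; set L := ln _; clear; lra.
have P0 : 0 < P by apply: powR_gt0.
have NP : N%:R `^ beta * (P * P) = N%:R :> R.
  rewrite /P -!powR_add //.
  by rewrite (_ : beta + _ = 1) ?powRr1 ?ltW //; clear; lra.
have B0 : 0 < N%:R `^ beta :> R by apply: powR_gt0.
have h2 : (8 * t * (4 ^ (256 * D ^ 2) * (1 + 512 * D ^ 3)))%N%:R <=
     t%:R * (E * P) :> R.
  rewrite mulnAC mulnC natrM ler_wpM2l ?ler0n //; apply: le_trans h1.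
  rewrite ler_nat; exact: block_size_bound.
rewrite -(ler_nat R); apply: le_trans h2 _.
have h3 : t%:R * (E * P) <= 3 * N%:R `^ beta * (E * P).
  by rewrite ler_pM2r // mulr_gt0.
have h4 : 3 * N%:R `^ beta * (E * P) * 2 <= N%:R.
  rewrite -[leRHS]NP.
  have -> : 3 * N%:R `^ beta * (E * P) * 2 = N%:R `^ beta * (6 * E * P) by ring.
  by rewrite ler_pM2l // ler_pM2r.
move: Nn h3 h4; clear; lra.
Qed.

Lemma prime_large_eventually (R : realType) (c1 alpha : R) : 0 < c1 -> 0 < alpha ->
  exists n0, forall n, (n0 <= n)%N -> forall (D p : nat) (e : R), 0 <= e <= 1 ->
  D%:R ^+ 2 <= 2 * (e * ln (2 * n - 2)%N%:R) + 2 ->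
  c1 * (2 * n - 2)%N%:R `^ alpha <= p%:R -> (512 * D ^ 2 < p)%N.
Proof.
move=> c10 a0; have ah0 : 0 < alpha / 2 by rewrite divr_gt0.
(* With [X = N ^ (alpha / 2)] and [ln N <= 2 / alpha * X], one gets [512 * D ^ 2 <= 1024 * ln N +
   1024 < k * X <= c1 * X ^ 2]. *)
pose k := 2048 / alpha + 1025.
have [n1 h1] := powR_eventually (1 + k / c1) ah0.
exists (n1 + 2)%N => n hn D p e /andP[e0 e1] DN pN.
have N0 : (0 < 2 * n - 2)%N by move: hn; clear; lia.
have {hn h1} key := h1 n (leq_trans (leq_addr _ _) hn).
move: (2 * n - 2)%N => N in N0 key pN DN *.
have Nr : 0 < N%:R :> R by rewrite ltr0n.
have L0 : 0 <= ln (N%:R : R) by apply: ln_ge0; rewrite ler1n.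
have hL := ln_le_powR (alpha / 2) Nr.
have XX : N%:R `^ alpha = N%:R `^ (alpha / 2) * N%:R `^ (alpha / 2) :> R.
  by rewrite -powR_add //; congr (_ `^ _); clear; lra.
move: hL key pN; rewrite XX; set X := _ `^ _; set L := ln _ in DN L0 * => hL key pN.
rewrite -(ltr_nat R) natrM natrX; apply: lt_le_trans pN.
have k0 : 0 < k by rewrite addr_gt0 // divr_gt0.
have X1 : 1 <= X by apply: le_trans key; rewrite lerDl divr_ge0 // ltW.
have k1 : k <= c1 * X.
  have : k / c1 <= X by apply: le_trans key; rewrite lerDr.
  by rewrite ler_pdivrMr // [X * _]mulrC.
have k2 : k * X <= c1 * X * X by rewrite ler_pM2r // (lt_le_trans ltr01 X1).
have L2 : 1024 * L <= 2048 / alpha * X.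
  have -> : 2048 / alpha * X = (2048 * X) / alpha by rewrite mulrAC.
  by rewrite ler_pdivlMr //; move: hL; clear; lra.
have eL : e * L <= L by rewrite ler_piMl.
rewrite mulrA; move: DN k2 L2 eL X1; rewrite /k; set q := 2048 / alpha; clear; lra.
Qed.

Lemma ln_powR_eventually (R : realType) (c2 alpha beta : R) : 0 < c2 -> 2 * alpha < beta ->
  exists n0, forall n, (n0 <= n)%N ->
  3 * ln (2 * n - 2)%N%:R * (c2 * (2 * n - 2)%N%:R `^ alpha) ^+ 2 <=
  (2 * n - 2)%N%:R `^ beta.
Proof.
move=> c20 ab; pose g := beta - 2 * alpha.
have g0 : 0 < g by rewrite subr_gt0.
have g20 : 0 < g / 2 by rewrite divr_gt0.
have [n1 h1] := powR_eventually (3 * c2 ^+ 2 * (2 / g)) g20.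
exists (n1 + 2)%N => n hn.
have N0 : (0 < 2 * n - 2)%N by move: hn; clear; lia.
have {hn h1} key := h1 n (leq_trans (leq_addr _ _) hn).
move: (2 * n - 2)%N => N in N0 key *.
have Nr : 0 < N%:R :> R by rewrite ltr0n.
have -> : N%:R `^ beta = N%:R `^ (g / 2) * N%:R `^ (g / 2) * (N%:R `^ alpha) ^+ 2 :> R.
  by rewrite expr2 -!powR_add //; congr (_ `^ _); rewrite /g; clear; lra.
rewrite exprMn mulrA ler_pM2r ?exprn_gt0 ?powR_gt0 //.
have X0 : 0 < N%:R `^ (g / 2) :> R by apply: powR_gt0.
apply: le_trans (_ : 3 * c2 ^+ 2 * (2 / g) * N%:R `^ (g / 2) <= _); last by rewrite ler_pM2r.
have := ln_le_powR (g / 2) Nr.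
set X := _ `^ _; set L := ln _ => hL.
have hL' : L <= 2 / g * X.
  by rewrite mulrAC ler_pdivlMr //; move: hL; clear; lra.
have -> : 3 * L * c2 ^+ 2 = 3 * c2 ^+ 2 * L by ring.
by rewrite -[leRHS]mulrA ler_pM2l // mulr_gt0 // exprn_gt0.
Qed.

Unset Implicit Arguments.
Theorem theorem7p1 (R : realType) (delta alpha : R) :
  0 <= delta -> delta < 1 -> delta / 3 < alpha -> alpha < 1 / 3 ->
  exists eps : R, 0 < eps /\
  forall c1 c2 : R, 0 < c1 -> c1 <= c2 ->
  exists (C : R) (n0 : nat), 0 < C /\
  forall n : nat, (n0 <= n)%N ->
  forall p : nat, prime p ->
    c1 * ((2 * n - 2)%N%:R `^ alpha) <= p%:R ->
    p%:R <= c2 * ((2 * n - 2)%N%:R `^ alpha) ->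
  forall l : nat, l%:R <= (2 * n - 2)%N%:R + (2 * n - 2)%N%:R `^ delta ->
  forall f : {ffun 'I_l -> bool} -> {ffun 'I_((2 * n - 2).+1) -> bool},
    is_local f (Num.sqrt (eps * ln ((2 * n - 2)%N%:R : R))) ->
    tvd R f (pm_ext n p) >= 1 / 2 - C / ln ((2 * n - 2)%N%:R : R).
Proof.
move=> d0 d1 da a1.
have a0 : 0 < alpha by lra.
(* [t] will be about [2 * N ^ beta]: [beta > delta] beats the excess inputs,
   [beta > 2 / 3 > 2 * alpha] beats [p ^ 2 * ln N], and [beta < 1] leaves room for enough blocks. *)
pose beta := (Num.max delta (2 / 3) + 1) / 2.
have bd : delta < beta.
  have : delta <= Num.max delta (2 / 3) by rewrite le_max lexx.
  rewrite /beta; lra.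
have b23 : 2 / 3 < beta.
  have : 2 / 3 <= Num.max delta (2 / 3) by rewrite le_max lexx orbT.
  rewrite /beta; lra.
have b1 : beta < 1.
  have : Num.max delta (2 / 3) < 1 by rewrite gt_max d1; lra.
  rewrite /beta; lra.
clearbody beta.
have b0 : 0 < beta by lra.
have ab : 2 * alpha < beta by lra.
have a10 : 0 < 1 - alpha by lra.
have b01 : 0 < beta < 1 by rewrite b0 b1.
have [eps /andP[e0 e1] [n1 h1]] := block_count_eventually b01.
exists eps; split=> // c1 c2 c10 c12.
have c20 : 0 < c2 by apply: lt_le_trans c12.
have [n2 h2] := prime_large_eventually c10 a0.
have [n3 h3] := ln_powR_eventually c20 ab.
have [n4 h4] := powR_eventually c2 a10.
(* The three terms pay for [1 / (2 * p)], for [eta / 2], and for [3 / t], of which [2 / t] is the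
   entropy term and [1 / t] comes from Chebyshev. *)
pose C := (2 * c1 * alpha)^-1 + 1 / 2 + 3 / beta.
have ca0 : 0 < 2 * c1 * alpha by rewrite !mulr_gt0.
have C0 : 0 < C by rewrite !addr_gt0 ?divr_gt0 ?invr_gt0.
exists C, (n1 + n2 + n3 + n4 + 2)%N; split=> // n hn p p_pr pc1 pc2 l hl f floc.
have /and5P[hn1 hn2 hn3 hn4 n_ge2] : [&& n1 <= n, n2 <= n, n3 <= n, n4 <= n & 2 <= n]%N.
  by move: hn; clear; lia.
move: {h1} (h1 n hn1) {h2} (h2 n hn2) {h3} (h3 n hn3) {h4} (h4 n hn4) => h1 h2 h3 h4.
set N := (2 * n - 2)%N in h1 h2 h3 h4 pc1 pc2 hl floc *.
have N2 : (2 <= N)%N by rewrite /N; move: n_ge2; clear; lia.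
have Nr : 0 < N%:R :> R by rewrite ltr0n (ltnW N2).
have N1 : 1 <= N%:R :> R by rewrite ler1n (ltnW N2).
have L0 : 0 < ln (N%:R : R) by apply: ln_gt0; rewrite ltr1n.
have [ln1|nl] := ltnP l n.-1.
  apply: le_trans (tvd_image R p f ln1).
  by rewrite gerBl divr_ge0 // ltW.
have [S hS] := fin_all_exists floc.
pose D := (Num.truncn (Num.sqrt (eps * ln (N%:R : R)))).+1.
have eL : 0 <= eps * ln N%:R by rewrite mulr_ge0 // ltW.
have S_le j : (#|S j| <= D)%N.
  by apply: leqW; rewrite truncn_ge_nat ?sqrtr_ge0 //; case: (hS j).
have DN : D%:R ^+ 2 <= 2 * (eps * ln (N%:R : R)) + 2 by apply: trunc_sqrt_sqr.
have D0 : (0 < D)%N by [].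
pose B := N%:R `^ beta : R.
have B0 : 0 < B by apply: powR_gt0.
have B1 : 1 <= B by have := ler_powR N1 (ltW b0); rewrite powRr0.
pose t := (Num.truncn (2 * B)).+1.
have t0 : (0 < t)%N by [].
have /andP[t2 t1] : (Num.truncn (2 * B))%:R <= 2 * B < t%:R.
  by apply: truncn_itv; rewrite mulr_ge0 // ltW.
have t3 : t%:R <= 3 * B by rewrite /t -natr1; move: t2 B1; clear; lra.
clearbody D t.
have hb := h1 D t D0 t3 DN.
have e01 : 0 <= eps <= 1 by rewrite ltW.
have hp := h2 D p eps e01 DN pc1.
have pN : p%:R <= N%:R :> R.
  apply: le_trans pc2 _.
  have NE : N%:R `^ (1 - alpha) * N%:R `^ alpha = N%:R :> R.
    by rewrite -powR_add // subrK powRr1 // ltW.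
  by rewrite -[leRHS]NE ler_pM2r // powR_gt0.
have heta := geometric_decay N2 (prime_gt0 p_pr) pc2 pN (ltW t1) h3.
have Ni : 0 <= N%:R^-1 :> R by rewrite invr_ge0 ltW.
have := tvd_blocks S_le (fun j => (hS j).2) D0 nl p_pr hp t0 hb Ni heta.
apply: le_trans.
have hlt : (2 * l <= 2 * N + t)%N.
  rewrite -(ler_nat R) natrD !natrM.
  have : N%:R `^ delta <= B by apply: ler_powR => //; apply: ltW.
  move: hl t1; clear; lra.
have ent := entropy_term R t0 hlt.
have q1 : p%:R^-1 / 2 <= (2 * c1 * alpha)^-1 / ln N%:R :> R.
  rewrite -!invfM lef_pV2 ?posrE ?mulr_gt0 ?ltr0n ?prime_gt0 //.
  have := ln_le_powR alpha Nr; rewrite -(ler_pM2l c10).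
  move: pc1; set L := ln _; set A := _ `^ _; set P := p%:R; clear; lra.
have q2 : N%:R^-1 <= (ln N%:R)^-1 :> R.
  by rewrite lef_pV2 ?posrE // ltW // ln_sublinear.
have q3 : t%:R^-1 <= (beta * ln N%:R)^-1 :> R.
  rewrite lef_pV2 ?posrE ?mulr_gt0 ?ltr0n //.
  by have := ln_le_powR beta Nr; rewrite -/B; move: t1 B0; clear; lra.
rewrite invfM in q3.
have CE : C / ln N%:R = (2 * c1 * alpha)^-1 / ln N%:R + (ln N%:R)^-1 / 2
    + 3 * (beta^-1 / ln N%:R) :> R by rewrite /C; ring.
rewrite CE; move: ent q1 q2 q3; clear.
set x1 := _ / (_ * _); set x2 := p%:R^-1; set x3 := _^-1 / ln _; set x4 := (ln _)^-1.
set x5 := N%:R^-1; set x6 := t%:R^-1; set x7 := beta^-1 * _.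
lra.
Qed.
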